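(* Let $S$ be a finite set of points in the plane that is in convex position. Then there exists a plane geometric graph with vertex set $S$ whose stretch factor is at most $\frac{3+4\pi}{3}$ and whose maximum vertex degree is at most $3$.
   Context: A geometric graph on $S$ has straight-segment edges weighted by Euclidean length; $d_G(u,v)$ is the shortest-path length. Its stretch factor is the smallest $t$ with $d_G(u,v)\le t|uv|$ for all $u,v\in S$. A graph is plane if no two edges cross. *)

(* Defs.v *)
From HB Require Import structures.
From mathcomp Require Import all_boot all_order all_algebra.
From mathcomp Require Import reals trigo.
Set Implicit Arguments. Unset Strict Implicit. Unset Printing Implicit Defensive.
Import Order.TTheory GRing.Theory Num.Theory.
Local Open Scope ring_scope.

Section Geom.
Variable R : realType.
Notation pt := (R * R)%type.

Definition edist (p q : pt) : R :=
  Num.sqrt ((p.1 - q.1) ^+ 2 + (p.2 - q.2) ^+ 2).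

Definition on_segment (a b x : pt) : Prop :=
  exists t : R, 0 <= t <= 1 /\
    x = (a.1 + t * (b.1 - a.1), a.2 + t * (b.2 - a.2)).

Variable n : nat.
Variable P : 'I_n -> pt.   (* the point set S = {P i}, P injective *)

Definition convex_position : Prop :=
  forall i : 'I_n, ~ exists w : 'I_n -> R,
    (forall j, 0 <= w j) /\ w i = 0 /\ \sum_j w j = 1 /\
    \sum_j w j * (P j).1 = (P i).1 /\ \sum_j w j * (P j).2 = (P i).2.

Definition simple_graph (E : rel 'I_n) : Prop :=
  (forall i j, E i j = E j i) /\ (forall i, ~~ E i i).

Definition plane (E : rel 'I_n) : Prop :=
  forall i j k l, E i j -> E k l ->
    ~ ((i == k) && (j == l) || (i == l) && (j == k)) ->
    forall x, on_segment (P i) (P j) x -> on_segment (P k) (P l) x ->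
      (x = P i \/ x = P j) /\ (x = P k \/ x = P l).

Fixpoint walk_length (x : 'I_n) (s : seq 'I_n) : R :=
  match s with
  | [::] => 0
  | y :: s' => edist (P x) (P y) + walk_length y s'
  end.

(* d_G(u,v) <= r : some walk in G from u to v has total length <= r
   (the shortest-path distance is the minimum of such lengths). *)
Definition dG_le (E : rel 'I_n) (u v : 'I_n) (r : R) : Prop :=
  exists s : seq 'I_n, [/\ path E u s, last u s = v & walk_length u s <= r].

Definition stretch_at_most (E : rel 'I_n) (t : R) : Prop :=
  forall u v : 'I_n, dG_le E u v (t * edist (P u) (P v)).

Definition max_degree_le (E : rel 'I_n) (k : nat) : Prop :=
  forall i : 'I_n, (#|[pred j | E i j]| <= k)%N.

End Geom.

(* Main.v *)
Require Import Defs.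
From HB Require Import structures.
From mathcomp Require Import all_boot all_order all_algebra.
From mathcomp Require Import reals trigo.
From mathcomp Require Import normed_module derive.
From mathcomp Require Import ring lra.
Import Order.TTheory GRing.Theory Num.Theory.
Import numFieldNormedType.Exports.
Local Open Scope ring_scope.
Set Implicit Arguments. Unset Strict Implicit. Unset Printing Implicit Defensive.

(* Let [p], [q] be a diametral pair, placed at (0,0) and (1,0) by a similarity.
   The points on either side of [pq], together with [p] and [q], form two chains
   that are the graphs of a strictly concave and of a strictly convex function of
   the abscissa. The spanner consists of the two chains and of a noncrossing
   matching between the points above and the points below [pq], obtained by taking
   a closest pair and recursing on its left and on its right.

   With c = 2 pi / 3, the part of a chain between two of its points [u], [v] has
   length at most c |uv|. For points [u], [v] on different sides, the recursion
   provides a matched pair [ab] with |ab| <= |uv| such that [ua] and [bv] are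
   opposite sides of the quadrilateral with diagonals [uv] and [ab]; hence
   |ua| + |bv| <= |uv| + |ab| <= 2 |uv|, and going through [ab] costs at most
   (1 + 2 c) |uv|.

   The chain bound uses that all points lie in the lune of [pq], through the Cauchy
   formula for the length of a convex curve in the form of a potential: if [W] is
   such that [x.1 cos t + x.2 sin t + W t] is nonincreasing in the direction [t]
   for all [x] of the chain (that is, [-W'] dominates the support function), then
   the length of the chain is at most the increase of that potential. Let [phi],
   [psi] be the angles of the triangles at [p] between [pq] and [pu] and at [q]
   between [pq] and [qv], and let cos kappa = 1 / c. If phi + psi <= 2 kappa, all
   edges of the chain make an angle at most kappa with a common direction.
   Otherwise the potential of a region containing the chain bounds the length of
   the chain completed by the segments [pu] and [vq], and |uv| is bounded below by
   its projection on a direction making an angle at least kappa with both. *)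

(** * Trigonometric estimates *)

Section Trigonometry.
Variable R : realType.
Implicit Types x t a b : R.

(** By the mean value theorem on [[0, x]]. The Taylor bounds below follow from one another with it,
    the difference in each being the derivative of the next difference. *)
Lemma ge0_of_derive_ge0 (f df : R -> R) :
  (forall x, is_derive x 1 f (df x)) -> 0 <= f 0 ->
  (forall x, 0 <= x -> 0 <= df x) -> forall x, 0 <= x -> 0 <= f x.
Proof.
move=> fd f0 df0 x; rewrite le_eqVlt => /predU1P[<- //|x0].
have fc y : y \in `[0, x] -> derivable f y 1 by move=> _; apply: ex_derive.
have [z] := MVT x0 (fun y _ => fd y) (derivable_within_continuous fc).
rewrite in_itv /= => /andP[z0 _] /eqP; rewrite subr0 subr_eq => /eqP ->.
by rewrite addr_ge0 // mulr_ge0 // ?df0 // ltW.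
Qed.

Lemma sin_le x : 0 <= x -> sin x <= x.
Proof.
move=> x0; rewrite -subr_ge0.
apply: (@ge0_of_derive_ge0 (fun y => y - sin y) (fun y => 1 - cos y)) => //.
- by rewrite sin0 subr0.
- by move=> y _; rewrite subr_ge0 cos_le1.
Qed.

Lemma cos_ge x : 0 <= x -> 1 - x ^+ 2 / 2 <= cos x.
Proof.
move=> x0; rewrite -subr_ge0.
apply: (@ge0_of_derive_ge0 (fun y => cos y - (1 - y ^+ 2 / 2))
  (fun y => y - sin y)) => //.
- by move=> y; apply: is_derive_eq; rewrite /GRing.scale /=; lra.
- by rewrite cos0; lra.
- by move=> y y0; rewrite subr_ge0 sin_le.
Qed.

Lemma sin_ge x : 0 <= x -> x - x ^+ 3 / 6 <= sin x.
Proof.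
move=> x0; rewrite -subr_ge0.
apply: (@ge0_of_derive_ge0 (fun y => sin y - (y - y ^+ 3 / 6))
  (fun y => cos y - (1 - y ^+ 2 / 2))) => //.
- by move=> y; apply: is_derive_eq; rewrite /GRing.scale /=; lra.
- by rewrite sin0; lra.
- by move=> y y0; rewrite subr_ge0 cos_ge.
Qed.

Lemma cos_le x : 0 <= x -> cos x <= 1 - x ^+ 2 / 2 + x ^+ 4 / 24.
Proof.
move=> x0; rewrite -subr_ge0.
apply: (@ge0_of_derive_ge0 (fun y => 1 - y ^+ 2 / 2 + y ^+ 4 / 24 - cos y)
  (fun y => sin y - (y - y ^+ 3 / 6))) => //.
- by move=> y; apply: is_derive_eq; rewrite /GRing.scale /=; lra.
- by rewrite cos0; lra.
- by move=> y y0; rewrite subr_ge0 sin_ge.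
Qed.

Lemma sin_le5 x : 0 <= x -> sin x <= x - x ^+ 3 / 6 + x ^+ 5 / 120.
Proof.
move=> x0; rewrite -subr_ge0.
apply: (@ge0_of_derive_ge0 (fun y => y - y ^+ 3 / 6 + y ^+ 5 / 120 - sin y)
  (fun y => 1 - y ^+ 2 / 2 + y ^+ 4 / 24 - cos y)) => //.
- by move=> y; apply: is_derive_eq; rewrite /GRing.scale /=; lra.
- by rewrite sin0; lra.
- by move=> y y0; rewrite subr_ge0 cos_le.
Qed.

Lemma pi_le4 : pi <= 4 :> R.
Proof. have := @pihalf_lt2 R; lra. Qed.

Lemma cos_lt a b : 0 <= a -> a < b -> b <= pi -> cos b < cos a.
Proof. by move=> a0 ab bp; rewrite ltr_cos ?in_itv /=; lra. Qed.

Lemma cos_nincr a b : 0 <= a -> a <= b -> b <= pi -> cos b <= cos a.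
Proof.
move=> a0; rewrite le_eqVlt => /predU1P[-> //|ab] bp.
by rewrite ltW ?cos_lt.
Qed.

(** The triple angle formula turns [cos (3 t) = 0] at [t = pi / 6] into
    [cos t * (1 - 4 * sin t ^+ 2) = 0], where [cos t] and [sin t] are positive. *)
Lemma sin_pi6 : sin (pi / 6) = 1 / 2 :> R.
Proof.
pose t : R := pi / 6; have pi0 := @pi_gt0 R.
have pE : pi / 2 = t + t + t by rewrite /t; field.
have c0 : cos t != 0 by rewrite gt_eqF // cos_gt0_pihalf // /t; lra.
have := cos_pihalf R; rewrite pE !cosD !sinD.
move=> e2.
have : cos t * (1 - 4 * sin t ^+ 2) = 0.
  rewrite (_ : 1 - _ = cos t ^+ 2 - 3 * sin t ^+ 2); last by rewrite cos2sin2; ring.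
  rewrite -[RHS]e2; ring.
move/eqP; rewrite mulf_eq0 (negPf c0) /= => /eqP e3.
have : (1 - 2 * sin t) * (1 + 2 * sin t) = 0 by rewrite -[RHS]e3; ring.
have s0 : 0 < sin t by rewrite sin_gt0_pi // /t; lra.
move/eqP; rewrite mulf_eq0 => /orP[] /eqP; lra.
Qed.

(** Otherwise [pi / 6 < 52 / 100], and the quintic Taylor bound gives
    [sin (pi / 6) <= sin (52 / 100) < 1 / 2]. *)
Lemma pi_lower : 312 / 100 <= pi :> R.
Proof.
have pi0 := @pi_gt0 R; have pi4 := pi_le4.
rewrite leNgt; apply/negP => lt.
have h1 : sin (pi / 6) <= sin (52 / 100) :> R.
  rewrite ltW // ltr_sin ?in_itv /=; have := @pi_ge2 R; lra.
have := @sin_le5 (52 / 100); rewrite sin_pi6 in h1; lra.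
Qed.

Lemma cos_pi6_sqr : cos (pi / 6) ^+ 2 = 3 / 4 :> R.
Proof. by rewrite cos2sin2 sin_pi6; field. Qed.

Lemma cos_pi6_gt0 : 0 < cos (pi / 6) :> R.
Proof. by rewrite cos_gt0_pihalf //; have := @pi_gt0 R; lra. Qed.

Lemma cos_pi3 : cos (pi / 3) = 1 / 2 :> R.
Proof.
have -> : pi / 3 = pi / 2 - pi / 6 :> R by field.
by rewrite cosB cos_pihalf sin_pihalf sin_pi6; ring.
Qed.

Definition kappa : R := acos (3 / (2 * pi)).

Lemma kappa_dom : 0 < 3 / (2 * @pi R) < 1 / 2.
Proof.
have p := pi_lower; rewrite divr_gt0 /=; try lra.
by rewrite ltr_pdivrMr; lra.
Qed.

Lemma cos_kappa : cos kappa = 3 / (2 * pi).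
Proof. by rewrite acosK // in_itv /=; have := kappa_dom; lra. Qed.

Lemma cos_kappaM : 2 * pi / 3 * cos kappa = 1.
Proof. have p := @pi_gt0 R; rewrite cos_kappa; field; lra. Qed.

Lemma kappa_ge : pi / 3 <= kappa.
Proof.
have d := kappa_dom; have p := @pi_gt0 R.
rewrite leNgt; apply/negP => lt.
have k0 : 0 <= kappa by apply: acos_ge0; lra.
have := @cos_lt kappa (pi / 3) k0 lt; rewrite cos_kappa cos_pi3; lra.
Qed.

(** With [x = 2 pi / 3 - 1] the claim amounts to [cos x <= 1 / (1 + x)], for which the quartic
    Taylor bound of [cos] is sharp enough. *)
Lemma kappa_le : 1 + kappa <= 2 * pi / 3.
Proof.
have d := kappa_dom; have p := pi_lower; have p4 := pi_le4.
rewrite leNgt; apply/negP => lt.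
pose x : R := 2 * pi / 3 - 1.
have x0 : 108 / 100 <= x by rewrite /x; lra.
have kpi : kappa <= pi by apply: acos_lepi; lra.
have := @cos_lt x kappa; rewrite cos_kappa.
have -> : 3 / (2 * pi) = (1 + x)^-1 by rewrite /x; field; lra.
have := @cos_le x; move=> /(_ ltac:(lra)) h /(_ ltac:(lra) ltac:(rewrite /x; lra) kpi).
have x2 : x <= 5 / 3 by rewrite /x; lra.
apply/negP; rewrite -leNgt; apply: (le_trans h).
rewrite -[leRHS]mul1r ler_pdivlMr; last lra.
have h2 : 0 <= (x - 108 / 100) * (5 / 3 - x) by apply: mulr_ge0; lra.
have h3 : 0 <= (x - 108 / 100) ^+ 2 by apply: sqr_ge0.
(* Multiplied by [1 + x], the Taylor bound leaves [x * (1 - x / 2 - k * x ^+ 2) <= 0] to prove. As a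
   concave function of [x], [k] is above an affine function on [[108 / 100, 5 / 3]], and [x ^+ 2] is
   above its tangent at [108 / 100]. *)
pose k : R := 1 / 2 - x / 24 - x ^+ 2 / 24.
have k1 : 575 / 1000 - 157 / 1000 * x <= k by rewrite /k; lra.
have h4 : 0 <= (575 / 1000 - 157 / 1000 * x) * (x - 108 / 100) ^+ 2.
  by apply: mulr_ge0; lra.
have h5 : 0 <= (k - (575 / 1000 - 157 / 1000 * x)) * x ^+ 2.
  by apply: mulr_ge0; [lra | apply: sqr_ge0].
have h6 : 1 - x / 2 - k * x ^+ 2 <= 0 by lra.
have : 0 <= x * (k * x ^+ 2 + x / 2 - 1) by apply: mulr_ge0; lra.
rewrite /k; lra.
Qed.

Lemma kappa_lt_pihalf : kappa < pi / 2.
Proof.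
have := kappa_le; have := pi_le4; have := pi_lower; lra.
Qed.
End Trigonometry.

(** * Lengths of convex chains *)

Section Nonincreasing.
Variable R : realType.
Implicit Types (f g : R -> R) (a b c x : R).

Definition nonincr_on f a b :=
  forall s t, a <= s -> s <= t -> t <= b -> f t <= f s.

Lemma nonincr_on_ext f g a b :
  (forall t, a <= t -> t <= b -> f t = g t) ->
  nonincr_on g a b -> nonincr_on f a b.
Proof. by move=> e h s t *; rewrite !e ?h //; lra. Qed.

Lemma nonincr_on_glue f a b c :
  nonincr_on f a b -> nonincr_on f b c -> nonincr_on f a c.
Proof.
move=> h1 h2 s t as_ st tc; case: (lerP t b) => [tb|bt]; first exact: h1.
case: (lerP b s) => [bs|sb]; first exact: h2.
by apply: (le_trans (h2 b t _ _ _) (h1 s b _ _ _)) => //; exact: ltW.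
Qed.

Lemma nonincr_on_sub f a b a' b' :
  a <= a' -> b' <= b -> nonincr_on f a b -> nonincr_on f a' b'.
Proof. by move=> aa bb h s t *; apply: h => //; lra. Qed.

(** The hypothesis bounds the derivative by 0. Around the midpoint [m], with half-length [h], the
    increment is [2 sin h (B cos m - A sin m) - 2 rho h], at most [2 rho (sin h - h)]. In the
    applications [rho] is the radius of curvature of a piece of boundary: 1 on an arc, 0 at a
    corner. *)
Lemma nonincr_on_piece (A B rho k a b : R) :
  0 <= rho -> b - a <= 2 * pi ->
  (forall m, a <= m -> m <= b -> B * cos m - A * sin m <= rho) ->
  nonincr_on (fun t => A * cos t + B * sin t - rho * t + k) a b.
Proof.
move=> rho0 ab H s t as_ st tb.
pose m := (s + t) / 2; pose h := (t - s) / 2.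
have -> : t = m + h by rewrite /m /h; field.
have -> : s = m - h by rewrite /m /h; field.
rewrite cosD sinD cosB sinB -subr_ge0.
have h0 : 0 <= h by rewrite /h; lra.
have hpi : h <= pi by rewrite /h; lra.
have sh : 0 <= sin h by apply: sin_ge0_pi; rewrite h0.
have := H m; move=> /(_ ltac:(rewrite /m; lra) ltac:(rewrite /m; lra)) Hm.
have := @sin_le R h h0 => sh1.
have e1 : 0 <= (rho - (B * cos m - A * sin m)) * sin h by apply: mulr_ge0; lra.
have e2 : 0 <= rho * (h - sin h) by apply: mulr_ge0; lra.
lra.
Qed.
End Nonincreasing.

Section ChainPotential.
Variables (R : realType) (n : nat) (P : 'I_n -> R * R).
Implicit Types (a b x : R * R) (i j u v : 'I_n) (s : seq 'I_n).

Lemma proj_le_edist a b (t : R) :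
  (b.1 - a.1) * cos t + (b.2 - a.2) * sin t <= edist a b.
Proof.
apply: (le_trans (ler_norm _)); rewrite -sqrtr_sqr; apply: ler_wsqrtr.
rewrite -subr_ge0.
have e : 1 = cos t ^+ 2 + sin t ^+ 2 by rewrite cos2Dsin2.
rewrite (_ : _ - _ = ((b.1 - a.1) * sin t - (b.2 - a.2) * cos t) ^+ 2).
  exact: sqr_ge0.
transitivity (((a.1 - b.1) ^+ 2 + (a.2 - b.2) ^+ 2) * (cos t ^+ 2 + sin t ^+ 2)
  - ((b.1 - a.1) * cos t + (b.2 - a.2) * sin t) ^+ 2); last by ring.
by rewrite cos2Dsin2 mulr1.
Qed.

(** This is the direction of the vector from [a] to [b] only if [a.1 < b.1]; chains are always run
    from left to right. *)
Definition angle a b : R := atan ((b.2 - a.2) / (b.1 - a.1)).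

Lemma angleE a b : a.1 < b.1 ->
  b.1 - a.1 = edist a b * cos (angle a b) /\
  b.2 - a.2 = edist a b * sin (angle a b).
Proof.
move=> ab; have d0 : 0 < b.1 - a.1 by rewrite subr_gt0.
set k := (b.2 - a.2) / (b.1 - a.1).
have c0 : 0 < cos (atan k) by rewrite cos_gt0_pihalf // atan_gtNpi2 atan_ltpi2.
have sE : sin (atan k) = k * cos (atan k).
  by rewrite -{2}(atanK k) /tan divfK // gt_eqF.
have q0 : 0 < 1 + k ^+ 2 by apply: ltr_pwDl; rewrite ?sqr_ge0.
have dE : edist a b = (b.1 - a.1) * Num.sqrt (1 + k ^+ 2).
  rewrite -{1}(ger0_norm (ltW d0)) -sqrtr_sqr -sqrtrM ?sqr_ge0 //.
  by congr Num.sqrt; rewrite /k; field; lra.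
have h : edist a b * cos (angle a b) = b.1 - a.1.
  by rewrite dE /angle cos_atan mulfK // gt_eqF // sqrtr_gt0.
split; first by rewrite h.
rewrite /angle -/k sE mulrCA h /k divfK // gt_eqF //.
Qed.

Lemma angle_bounds a b : - (pi / 2) < angle a b < pi / 2.
Proof. by rewrite atan_gtNpi2 atan_ltpi2. Qed.

(** The directions of the edges decrease from at most [hi] to at least [lo], as on the graph of a
    concave function. *)
Fixpoint turns_right (lo hi : R) u s : Prop :=
  match s with
  | [::] => lo <= hi
  | v :: s' => [/\ (P u).1 < (P v).1, angle (P u) (P v) <= hi &
                   turns_right lo (angle (P u) (P v)) v s']
  end.

Lemma turns_right_le lo hi u s : turns_right lo hi u s -> lo <= hi.
Proof.
elim: s hi u => //= v s IH hi u [_ h1 /IH h2]; exact: le_trans h1.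
Qed.

Definition potential (W : R -> R) x (t : R) := x.1 * cos t + x.2 * sin t + W t.

(* Moving along an edge of direction [t] raises [potential W _ t] by exactly
   the length of the edge, and turning right does not decrease it. *)
Lemma walk_length_potential W lo hi u s :
  turns_right lo hi u s ->
  (forall i, i \in u :: s -> nonincr_on (potential W (P i)) lo hi) ->
  walk_length P u s <= potential W (P (last u s)) lo - potential W (P u) hi.
Proof.
elim: s hi u => [|v s IH] hi u /= tr mono.
  by rewrite subr_ge0 mono ?mem_head.
have [uv a_hi tr'] := tr; set t := angle _ _ in a_hi tr' *.
have lo_t := turns_right_le tr'.
have {}IH := IH t v tr' _.
have /IH {}IH i : i \in v :: s -> nonincr_on (potential W (P i)) lo t.
  move=> iv; apply: nonincr_on_sub (mono i _) => //.
  by rewrite inE iv orbT.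
have [e1 e2] := angleE uv; rewrite -/t in e1 e2.
have step : potential W (P v) t - potential W (P u) t = edist (P u) (P v).
  transitivity ((((P v).1 - (P u).1)) * cos t + ((P v).2 - (P u).2) * sin t).
    by rewrite /potential; ring.
  rewrite e1 e2 -[RHS]mulr1 -(cos2Dsin2 t); ring.
have turn := mono u (mem_head _ _) t hi lo_t a_hi (lexx _).
lra.
Qed.

(** Each edge is at most [k] times its projection on the direction [d], and these projections add up
    to the projection of the segment joining the ends. *)
Lemma walk_length_proj lo hi k d u s :
  turns_right lo hi u s -> 0 <= k ->
  (forall t, lo <= t -> t <= hi -> 1 <= k * cos (t - d)) ->
  walk_length P u s <= k * edist (P u) (P (last u s)).
Proof.
move=> tr k0 H.
apply: (@le_trans _ _ (k * (((P (last u s)).1 - (P u).1) * cos d +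
    ((P (last u s)).2 - (P u).2) * sin d))); last first.
  by rewrite ler_wpM2l // proj_le_edist.
elim: s hi u tr H => [|v s IH] hi u /= tr H; first by lra.
have [uv a_hi tr'] := tr; set t := angle _ _ in a_hi tr' *.
have lo_t := turns_right_le tr'.
have {}IH := IH t v tr' (fun w h1 h2 => H w h1 (le_trans h2 a_hi)).
have [e1 e2] := angleE uv; rewrite -/t in e1 e2.
have ed0 : 0 <= edist (P u) (P v) by apply: sqrtr_ge0.
have := H t lo_t a_hi; rewrite cosB => Ht.
have : 0 <= edist (P u) (P v) * (k * (cos t * cos d + sin t * sin d) - 1).
  by apply: mulr_ge0; lra.
have -> : (P (last v s)).1 - (P u).1 =
  ((P (last v s)).1 - (P v).1) + edist (P u) (P v) * cos t by rewrite -e1; ring.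
have -> : (P (last v s)).2 - (P u).2 =
  ((P (last v s)).2 - (P v).2) + edist (P u) (P v) * sin t by rewrite -e2; ring.
lra.
Qed.
End ChainPotential.

(** * The potentials of regions in the lune *)

Section Potentials.
Variable R : realType.
Implicit Types (x : R * R) (m t phi psi : R).

Lemma support_disk (A B m : R) : A ^+ 2 + B ^+ 2 <= 1 ->
  B * cos m - A * sin m <= 1.
Proof.
move=> AB; have e := cos2Dsin2 m.
have h1 : 0 <= (B - cos m) ^+ 2 by apply: sqr_ge0.
have h2 : 0 <= (A + sin m) ^+ 2 by apply: sqr_ge0.
lra.
Qed.

Definition in_lune x :=
  x.1 ^+ 2 + x.2 ^+ 2 <= 1 /\ (x.1 - 1) ^+ 2 + x.2 ^+ 2 <= 1.

(** Minus its derivative is the support function of the lune for the normal [(- sin t, cos t)]: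
    first the arc centred at [(1, 0)], then the apex [(1 / 2, cos (pi / 6))], then the arc centred
    at [(0, 0)]. The additive constants make the pieces agree at [pi / 6] and [- (pi / 6)]. *)
Definition lune_offset t : R :=
  if pi / 6 <= t then pi / 2 - t - cos t
  else if - (pi / 6) <= t then pi / 3 - cos t / 2 - cos (pi / 6) * sin t
  else pi / 6 - t.

Lemma lune_potential x : in_lune x ->
  nonincr_on (potential lune_offset x) (- (pi / 2)) (pi / 2).
Proof.
move=> [d0 d1]; have p0 := @pi_gt0 R.
set C := cos (pi / 6) : R.
have C2 : C ^+ 2 = 3 / 4 := cos_pi6_sqr R.
have C0 : 0 < C := cos_pi6_gt0 R.
apply: (@nonincr_on_glue _ _ _ (- (pi / 6))).
  apply: (@nonincr_on_ext _ _ (fun t => x.1 * cos t + x.2 * sin t - 1 * t + pi / 6)).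
    move=> t t1 t2; rewrite /potential /lune_offset.
    rewrite ifF; last by apply/negbTE; rewrite -ltNge; lra.
    case: ifP => [t3|_]; last by ring.
    have -> : t = - (pi / 6) by lra.
    by rewrite cosN sinN sin_pi6 -/C; field.
  apply: nonincr_on_piece; [lra|lra|] => m _ _; exact: support_disk.
apply: (@nonincr_on_glue _ _ _ (pi / 6)); last first.
  apply: (@nonincr_on_ext _ _
    (fun t => (x.1 - 1) * cos t + x.2 * sin t - 1 * t + pi / 2)).
    by move=> t t1 t2; rewrite /potential /lune_offset t1; ring.
  apply: nonincr_on_piece; [lra|lra|] => m _ _; exact: support_disk.
apply: (@nonincr_on_ext _ _
  (fun t => (x.1 - 1 / 2) * cos t + (x.2 - C) * sin t - 0 * t + pi / 3)).
  move=> t t1 t2; rewrite /potential /lune_offset t1.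
  case: ifP => [t3|_]; last by rewrite -/C; field.
  have -> : t = pi / 6 by lra.
  by rewrite sin_pi6 -/C; field.
apply: nonincr_on_piece; [lra|lra|] => m m1 m2.
(* The normal directions between the two arcs are nonnegative combinations of
   the normals to the arcs at the apex [(1/2, C)] of the lune. *)
have c3 := @cos_pi3 R.
have s3 : sin (pi / 3) = C.
  have -> : pi / 3 = pi / 2 - pi / 6 :> R by field.
  by rewrite sinB cos_pihalf sin_pihalf /C; ring.
have a0 : 0 <= cos m / 2 - C * sin m.
  rewrite (_ : _ - _ = cos (m + pi / 3)); last by rewrite cosD c3 s3; field.
  by apply: cos_ge0_pihalf; lra.
have b0 : 0 <= cos m / 2 + C * sin m.
  rewrite (_ : _ + _ = cos (m - pi / 3)); last by rewrite cosB c3 s3; field.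
  by apply: cos_ge0_pihalf; lra.
(* Each disk lies on the inner side of its tangent at the apex. *)
have u0 : (x.1 - 1 / 2) * (1 / 2) + (x.2 - C) * C <= 0.
  have : 0 <= (x.1 - 1 / 2) ^+ 2 by apply: sqr_ge0.
  have : 0 <= (x.2 - C) ^+ 2 by apply: sqr_ge0.
  nra.
have v0 : - (x.1 - 1 / 2) * (1 / 2) + (x.2 - C) * C <= 0.
  have : 0 <= (x.1 - 1 / 2) ^+ 2 by apply: sqr_ge0.
  have : 0 <= (x.2 - C) ^+ 2 by apply: sqr_ge0.
  nra.
set U := _ + _ in u0; set V := _ + _ in v0.
have h1 : 0 <= - U * (cos m / 2 - C * sin m) by apply: mulr_ge0; lra.
have h2 : 0 <= - V * (cos m / 2 + C * sin m) by apply: mulr_ge0; lra.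
rewrite -(ler_pM2l C0) mulr0 -oppr_ge0.
rewrite (_ : - _ = - U * (cos m / 2 - C * sin m) + - V * (cos m / 2 + C * sin m)).
  exact: addr_ge0.
by rewrite /U /V; field.
Qed.

(** The same for the disk about [(1, 0)] cut by the line from [(1, 0)] in the direction
    [(- cos psi, sin psi)]; its corner is [(1 - cos psi, sin psi)], where the line meets the
    circle. *)
Definition left_offset psi t : R :=
  if pi / 2 - psi <= t then pi / 2 - t - cos t
  else psi - (1 - cos psi) * cos t - sin psi * sin t.

Lemma left_potential psi x : 0 <= psi -> psi <= pi / 2 ->
  (x.1 - 1) ^+ 2 + x.2 ^+ 2 <= 1 ->
  (x.1 - 1) * sin psi + x.2 * cos psi <= 0 ->
  nonincr_on (potential (left_offset psi) x) (- psi) (pi / 2).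
Proof.
move=> psi0 psi1 d1 below; have p0 := @pi_gt0 R.
have e := cos2Dsin2 psi.
apply: (@nonincr_on_glue _ _ _ (pi / 2 - psi)); last first.
  apply: (@nonincr_on_ext _ _
    (fun t => (x.1 - 1) * cos t + x.2 * sin t - 1 * t + pi / 2)).
    by move=> t t1 t2; rewrite /potential /left_offset t1; ring.
  apply: nonincr_on_piece; [lra|lra|] => m _ _; exact: support_disk.
apply: (@nonincr_on_ext _ _
  (fun t => (x.1 - (1 - cos psi)) * cos t + (x.2 - sin psi) * sin t - 0 * t + psi)).
  move=> t t1 t2; rewrite /potential /left_offset.
  case: ifP => [t3|_]; last by ring.
  have -> : t = pi / 2 - psi by lra.
  by rewrite cosB sinB cos_pihalf sin_pihalf; ring.
apply: nonincr_on_piece; [lra|lra|] => m m1 m2.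
have a0 : 0 <= cos (m + psi) by apply: cos_ge0_pihalf; lra.
have b0 : 0 <= sin (m + psi) by apply: sin_ge0_pi; lra.
(* At the corner, [U] is the component along the normal of the cutting line and [V] the one along
   the normal of the circle; the normals in between combine these two with nonnegative
   coefficients. *)
set U := _ + _ in below.
set V := - (x.1 - (1 - cos psi)) * cos psi + (x.2 - sin psi) * sin psi.
have v0 : V <= 0.
  have : 0 <= (x.1 - (1 - cos psi)) ^+ 2 by apply: sqr_ge0.
  have : 0 <= (x.2 - sin psi) ^+ 2 by apply: sqr_ge0.
  rewrite /V; nra.
have h1 : 0 <= - U * cos (m + psi) by apply: mulr_ge0; lra.
have h2 : 0 <= - V * sin (m + psi) by apply: mulr_ge0; lra.
rewrite (_ : _ - _ = U * cos (m + psi) + V * sin (m + psi)); first by lra.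
have em : cos m = cos (m + psi) * cos psi + sin (m + psi) * sin psi.
  by rewrite -cosB addrK.
have sm : sin m = sin (m + psi) * cos psi - cos (m + psi) * sin psi.
  by rewrite -sinB addrK.
rewrite /U /V em sm; set a := cos (m + psi); set b := sin (m + psi).
ring.
Qed.

(** The mirror image: the disk about [(0, 0)] cut by the line from [(0, 0)] in the direction [phi],
    with corner [(cos phi, sin phi)]. *)
Definition right_offset phi t : R :=
  if phi - pi / 2 <= t then 1 - cos phi * cos t - sin phi * sin t
  else 1 + phi - pi / 2 - t.

Lemma right_potential phi x : 0 <= phi -> phi <= pi / 2 ->
  x.1 ^+ 2 + x.2 ^+ 2 <= 1 ->
  x.2 * cos phi - x.1 * sin phi <= 0 ->
  nonincr_on (potential (right_offset phi) x) (- (pi / 2)) phi.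
Proof.
move=> phi0 phi1 d0 below; have p0 := @pi_gt0 R.
have e := cos2Dsin2 phi.
apply: (@nonincr_on_glue _ _ _ (phi - pi / 2)).
  apply: (@nonincr_on_ext _ _
    (fun t => x.1 * cos t + x.2 * sin t - 1 * t + (1 + phi - pi / 2))).
    move=> t t1 t2; rewrite /potential /right_offset.
    case: ifP => [t3|_]; last by ring.
    have -> : t = phi - pi / 2 by lra.
    by rewrite cosB sinB cos_pihalf sin_pihalf; ring.
  apply: nonincr_on_piece; [lra|lra|] => m _ _; exact: support_disk.
apply: (@nonincr_on_ext _ _
  (fun t => (x.1 - cos phi) * cos t + (x.2 - sin phi) * sin t - 0 * t + 1)).
  by move=> t t1 t2; rewrite /potential /right_offset t1; ring.
apply: nonincr_on_piece; [lra|lra|] => m m1 m2.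
have a0 : 0 <= cos (phi - m) by apply: cos_ge0_pihalf; lra.
have b0 : 0 <= sin (phi - m) by apply: sin_ge0_pi; lra.
set U := _ - _ in below.
set V := (x.1 - cos phi) * cos phi + (x.2 - sin phi) * sin phi.
have v0 : V <= 0.
  have : 0 <= (x.1 - cos phi) ^+ 2 by apply: sqr_ge0.
  have : 0 <= (x.2 - sin phi) ^+ 2 by apply: sqr_ge0.
  rewrite /V; nra.
have h1 : 0 <= - U * cos (phi - m) by apply: mulr_ge0; lra.
have h2 : 0 <= - V * sin (phi - m) by apply: mulr_ge0; lra.
rewrite (_ : _ - _ = U * cos (phi - m) + V * sin (phi - m)); first by lra.
have em : cos m = cos phi * cos (phi - m) + sin phi * sin (phi - m).
  by rewrite -cosB subKr.
have sm : sin m = sin phi * cos (phi - m) - cos phi * sin (phi - m).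
  by rewrite -sinB subKr.
rewrite /U /V em sm; set a := cos (phi - m); set b := sin (phi - m).
ring.
Qed.
End Potentials.

(** * The stretch factor of a single chain *)

Section ChainStretch.
Variables (R : realType) (n : nat) (P : 'I_n -> R * R).
Notation c := (2 * pi / 3 : R).

(** Since [1 + kappa <= c], it suffices that [c (1 - cos d) <= d]; this follows from
    [1 - cos d <= d ^+ 2 / 2] and [c d <= 2]. *)
Lemma kappa_cos_ge (d : R) : 0 <= d -> d <= pi / 6 -> 1 + (kappa R - d) <= c * cos d.
Proof.
move=> d0 d1; have k := kappa_le R; have p := pi_lower R; have p4 := pi_le4 R.
have h := cos_ge d0.
have h1 : 0 <= c * (cos d - (1 - d ^+ 2 / 2)) by apply: mulr_ge0; lra.
have h2 : c * d <= 2.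
  have h3 : 0 <= (pi / 6 - d) * pi by apply: mulr_ge0; lra.
  have h4 : 0 <= (4 - pi) * pi :> R by apply: mulr_ge0; lra.
  lra.
have h3 : 0 <= d * (2 - c * d) by apply: mulr_ge0; lra.
lra.
Qed.

Lemma cos_far (d : R) : kappa R <= d -> d <= pi -> c * cos d <= 1.
Proof.
move=> kd dpi; rewrite -[leRHS](cos_kappaM R) ler_wpM2l //; have p := @pi_gt0 R; first by lra.
by apply: cos_nincr => //; have := kappa_ge R; lra.
Qed.

(** The ends are given in polar coordinates about [(0, 0)] and [(1, 0)], so that [r = 0] or [t = 0]
    covers a chain starting or ending at one of these two points. *)
Lemma chain_stretch (u : 'I_n) (s : seq 'I_n) (phi psi r t : R) :
  let v := last u s in
  turns_right P (- psi) phi u s ->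
  0 <= r -> P u = (r * cos phi, r * sin phi) ->
  0 <= t -> P v = (1 - t * cos psi, t * sin psi) ->
  0 <= phi <= pi / 2 -> 0 <= psi <= pi / 2 ->
  (forall i, i \in u :: s ->
    [/\ in_lune (P i), (P i).2 * cos phi - (P i).1 * sin phi <= 0 &
        ((P i).1 - 1) * sin psi + (P i).2 * cos psi <= 0]) ->
  walk_length P u s <= c * edist (P u) (P v).
Proof.
move=> v tr r0 Pu t0 Pv /andP[phi0 phi1] /andP[psi0 psi1] Hs.
set k := kappa R; have k3 := kappa_ge R; have kp := kappa_lt_pihalf R.
have p := pi_lower R; have p4 := pi_le4 R; rewrite -/k in k3 kp.
have e1 := cos2Dsin2 phi; have e2 := cos2Dsin2 psi.
(* This absorbs the terms [phi + cos phi] and [psi + cos psi] left by the potentials. *)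
have compl (a : R) : a <= pi / 2 -> cos a <= pi / 2 - a.
  move=> ha; apply: le_trans (sin_le _); last by rewrite subr_ge0.
  by rewrite sinB cos_pihalf sin_pihalf; lra.
have cphi := compl _ phi1; have cpsi := compl _ psi1.
have [small|big] := lerP (phi + psi) (2 * k).
  (* The common direction is the middle of the range [[- psi, phi]] of edge directions. *)
  apply: (@walk_length_proj _ _ _ _ _ c ((phi - psi) / 2) _ _ tr); first by lra.
  move=> a a1 a2; rewrite -[leLHS](cos_kappaM R) ler_wpM2l //; first by lra.
  rewrite -[cos (a - _)]cos_norm; apply: cos_nincr.
  - exact: normr_ge0.
  - by rewrite ler_norml -/k; lra.
  - by rewrite -/k; lra.
have potu W : potential W (P u) phi = r + W phi.
  rewrite Pu /potential /= -[X in _ = X + _]mulr1 -e1; ring.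
have potv W : potential W (P v) (- psi) = cos psi - t + W (- psi).
  rewrite (_ : cos psi - t = cos psi - t * (cos psi ^+ 2 + sin psi ^+ 2)).
    by rewrite Pv /potential /= cosN sinN; ring.
  by rewrite e2 mulr1.
(* The left-hand side is the length of the chain completed by the segments from [(0, 0)] to [P u]
   and from [P v] to [(1, 0)]. *)
have len W : (forall i, i \in u :: s ->
    nonincr_on (potential W (P i)) (- psi) phi) ->
    walk_length P u s + r + t <= cos psi + W (- psi) - W phi.
  by move=> /(walk_length_potential tr); rewrite -/v potu potv; lra.
have proj d : cos d - t * cos (psi + d) - r * cos (phi - d) <= edist (P u) (P v).
  apply: le_trans (proj_le_edist _ _ d); rewrite Pu Pv /= cosD cosB; lra.
(* If both added segments make an angle at least [kappa] with [d], then [c] times their projections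
   is at most [r + t], which the completed length pays for. *)
have wrap d : phi - d <= pi -> psi + d <= pi -> k <= phi - d -> k <= psi + d ->
    walk_length P u s + r + t <= c * cos d ->
    walk_length P u s <= c * edist (P u) (P v).
  move=> d1 d2 d3 d4 w.
  have c0 : 0 <= c by lra.
  have h1 := ler_wpM2l c0 (proj d).
  have h2 := ler_wpM2l r0 (cos_far d3 d1).
  have h3 := ler_wpM2l t0 (cos_far d4 d2).
  lra.
have [kpsi|psik] := lerP k psi.
  have [kphi|phik] := lerP k phi.
    (* Both angles are at least [kappa]. The lune bounds the completed length by
       [phi + cos phi + psi + cos psi - pi / 3], hence by [c]. *)
    apply: (wrap 0); try lra; rewrite cos0.
    have inl : forall i, i \in u :: s -> nonincr_on (potential (@lune_offset R) (P i)) (- psi) phi.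
      move=> i /Hs[h _ _]; apply: nonincr_on_sub (lune_potential h); lra.
    have := len _ inl.
    rewrite {1}/lune_offset ifF; last by apply/negbTE; rewrite -ltNge; lra.
    rewrite ifF; last by apply/negbTE; rewrite -ltNge; lra.
    rewrite /lune_offset ifT; lra.
  (* Here [phi < kappa], and [d] is at angle exactly [kappa] from the first segment. The cut disk
     about [(0, 0)] bounds the completed length by [1 + phi]. *)
  apply: (wrap (phi - k)); try lra.
  rewrite -cosN; apply: le_trans (kappa_cos_ge (d := - (phi - k)) _ _); rewrite -/k; try lra.
  have inl : forall i, i \in u :: s ->
      nonincr_on (potential (right_offset phi) (P i)) (- psi) phi.
    move=> i /Hs[[h _] h1 _]; apply: nonincr_on_sub (right_potential phi0 phi1 h h1); lra.
  have := len _ inl; rewrite {2}/right_offset ifT; last lra.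
  rewrite {1}/right_offset ifF; last by apply/negbTE; rewrite -ltNge; lra.
  lra.
(* The mirror case [psi < kappa], with the bound [1 + psi]. *)
apply: (wrap (k - psi)); try lra.
apply: le_trans (kappa_cos_ge (d := k - psi) _ _); rewrite -/k; try lra.
have inl : forall i, i \in u :: s ->
    nonincr_on (potential (left_offset psi) (P i)) (- psi) phi.
  move=> i /Hs[[_ h] _ h1]; apply: nonincr_on_sub (left_potential psi0 psi1 h h1); lra.
have := len _ inl; rewrite {2}/left_offset ifT; last lra.
rewrite {1}/left_offset ifF; last by apply/negbTE; rewrite -ltNge; lra.
rewrite cosN sinN; lra.
Qed.
End ChainStretch.

(** * Distances *)

Section Metric.
Variable R : realType.
Implicit Types a b x : R * R.

Lemma edistC a b : edist a b = edist b a.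
Proof. by rewrite /edist -[a.1 - _]opprB -[a.2 - _]opprB !sqrrN. Qed.

Lemma edist_ge0 a b : 0 <= edist a b. Proof. exact: sqrtr_ge0. Qed.

Lemma edist_triangle a b x : edist a b <= edist a x + edist x b.
Proof.
have sE y z : edist y z ^+ 2 = (y.1 - z.1) ^+ 2 + (y.2 - z.2) ^+ 2.
  by rewrite sqr_sqrtr // addr_ge0 ?sqr_ge0.
have h1 := edist_ge0 a x; have h2 := edist_ge0 x b.
rewrite -ler_sqr ?nnegrE ?addr_ge0 ?edist_ge0 // sqrrD !sE.
set dot := (a.1 - x.1) * (x.1 - b.1) + (a.2 - x.2) * (x.2 - b.2).
suff : dot <= edist a x * edist x b by rewrite /dot; lra.
apply: (le_trans (ler_norm _)).
rewrite -ler_sqr ?nnegrE ?mulr_ge0 // real_normK ?num_real // exprMn !sE.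
rewrite -subr_ge0 (_ : _ - _ =
  ((a.1 - x.1) * (x.2 - b.2) - (a.2 - x.2) * (x.1 - b.1)) ^+ 2) ?sqr_ge0 //.
by rewrite /dot; ring.
Qed.

Lemma edist_segment a b t : 0 <= t ->
  edist a (a.1 + t * (b.1 - a.1), a.2 + t * (b.2 - a.2)) = t * edist a b.
Proof.
move=> t0; rewrite /edist -[k in _ = k * _](ger0_norm t0) -sqrtr_sqr -sqrtrM ?sqr_ge0 //=.
by congr Num.sqrt; ring.
Qed.

Lemma edist_on_segment a b x : on_segment a b x ->
  edist a x + edist x b = edist a b.
Proof.
case=> t [/andP[t0 t1] ->]; rewrite edist_segment // [k in _ + k]edistC.
have -> : (a.1 + t * (b.1 - a.1), a.2 + t * (b.2 - a.2)) =
  (b.1 + (1 - t) * (a.1 - b.1), b.2 + (1 - t) * (a.2 - b.2)).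
  by congr pair; ring.
by rewrite edist_segment ?subr_ge0 // (edistC b a); ring.
Qed.
End Metric.

Section GraphDistance.
Variables (R : realType) (n : nat) (P : 'I_n -> R * R) (E : rel 'I_n).
Implicit Types u v w : 'I_n.

Lemma dG_le_trans u v w r1 r2 :
  dG_le P E u v r1 -> dG_le P E v w r2 -> dG_le P E u w (r1 + r2).
Proof.
case=> s1 [p1 l1 w1] [s2 [p2 l2 w2]]; exists (s1 ++ s2); split.
- by rewrite cat_path p1 l1.
- by rewrite last_cat l1.
- have -> : walk_length P u (s1 ++ s2) = walk_length P u s1 + walk_length P v s2.
    rewrite -l1; elim: s1 u {p1 l1 w1} => [|x s IH] u /=; first by rewrite add0r.
    by rewrite IH addrA.
  exact: lerD.
Qed.

Lemma dG_le_edge u v : E u v -> dG_le P E u v (edist (P u) (P v)).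
Proof. by move=> e; exists [:: v]; rewrite /= e addr0. Qed.

Lemma dG_le_weaken u v r1 r2 : r1 <= r2 -> dG_le P E u v r1 -> dG_le P E u v r2.
Proof. by move=> r12 [s [ps ls ws]]; exists s; split=> //; apply: le_trans r12. Qed.

Lemma dG_le_sym u v r : symmetric E -> dG_le P E u v r -> dG_le P E v u r.
Proof.
move=> symE [s [ps <- ws]]; apply: dG_le_weaken ws _.
elim: s u ps => [|x s IH] u /=; first by exists [::].
case/andP=> ux /IH h; rewrite addrC; apply: dG_le_trans h _.
by rewrite edistC; apply: dG_le_edge; rewrite symE.
Qed.
End GraphDistance.

(** * The upper chain *)

Section UpperChain.
Variables (R : realType) (n : nat) (P : 'I_n -> R * R) (p q : 'I_n).
Hypothesis convP : convex_position P.
Hypotheses (Pp : P p = (0, 0)) (Pq : P q = (1, 0)).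
Hypothesis luneP : forall i, in_lune (P i).
Notation X i := (P i).1.
Notation Y i := (P i).2.
Implicit Types i j k u v : 'I_n.

(** The indices may coincide, in which case their weights add up. Four are enough for two points of
    a chain together with [p] and [q]. *)
Lemma not_convex_comb4 i j1 j2 j3 j4 (a1 a2 a3 a4 : R) :
  j1 != i -> j2 != i -> j3 != i -> j4 != i ->
  0 <= a1 -> 0 <= a2 -> 0 <= a3 -> 0 <= a4 -> a1 + a2 + a3 + a4 = 1 ->
  a1 * X j1 + a2 * X j2 + a3 * X j3 + a4 * X j4 = X i ->
  a1 * Y j1 + a2 * Y j2 + a3 * Y j3 + a4 * Y j4 = Y i -> False.
Proof.
move=> n1 n2 n3 n4 p1 p2 p3 p4 s1 sX sY.
pose w j : R := a1 * (j == j1)%:R + a2 * (j == j2)%:R + a3 * (j == j3)%:R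
  + a4 * (j == j4)%:R.
have wE (f : 'I_n -> R) :
    \sum_j w j * f j = a1 * f j1 + a2 * f j2 + a3 * f j3 + a4 * f j4.
  have one a j0 : \sum_j a * (j == j0)%:R * f j = a * f j0.
    rewrite (bigD1 j0) //= eqxx mulr1 big1 ?addr0 // => j /negPf ->.
    by rewrite mulr0 mul0r.
  under eq_bigr do rewrite !mulrDl.
  by rewrite !big_split /= !one.
apply: (convP (i := i)); exists w; split.
  by move=> j; rewrite !addr_ge0 // mulr_ge0 // ler0n.
split.
  by rewrite /w ![i == _]eq_sym (negPf n1) (negPf n2) (negPf n3) (negPf n4) !mulr0 !addr0.
split; last by rewrite !wE.
by under eq_bigr do rewrite -[w _]mulr1; rewrite (wE (fun=> 1)) !mulr1.
Qed.

Lemma abscissa_ge0_le1 i : 0 <= X i <= 1.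
Proof.
have [h1 h2] := luneP i; have := sqr_ge0 (Y i) => h3.
by apply/andP; split; nra.
Qed.

Lemma abscissa_interior i : Y i != 0 -> 0 < X i < 1.
Proof.
move=> y0; have [h1 h2] := luneP i.
have h3 : 0 < Y i ^+ 2 by rewrite exprn_even_gt0.
by apply/andP; split; nra.
Qed.

Lemma ordinate_neq0 i : i != p -> i != q -> Y i != 0.
Proof.
move=> ip iq; apply/eqP => y0; have /andP[x0 x1] := abscissa_ge0_le1 i.
apply: (@not_convex_comb4 i p q p q (1 - X i) (X i) 0 0);
  rewrite ?Pp ?Pq /= ?(eq_sym p) ?(eq_sym q) //; lra.
Qed.

(** Otherwise [P i] lies on the vertical segment from the chord down to its foot on [pq], hence is a
    convex combination of [P j], [P k], [P p] and [P q]. The case [j = k] is allowed. *)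
Lemma not_below_chord i j k (t : R) : 0 < Y i -> j != i -> k != i -> 0 <= t <= 1 ->
  X i = (1 - t) * X j + t * X k -> (1 - t) * Y j + t * Y k < Y i.
Proof.
move=> yi ji ki /andP[t0 t1] xE; rewrite ltNge; apply/negP => yle.
have /andP[x0 x1] := abscissa_interior (lt0r_neq0 yi).
set S := _ + _ in yle; have S0 : 0 < S by lra.
pose l := Y i / S.
have l0 : 0 <= l by rewrite divr_ge0 // ltW.
have l1 : l <= 1 by rewrite ler_pdivrMr // mul1r.
have lS : l * S = Y i by rewrite /l divfK // gt_eqF.
have np : p != i by apply: contraTneq yi => <-; rewrite Pp /= ltxx.
have nq : q != i by apply: contraTneq yi => <-; rewrite Pq /= ltxx.
apply: (@not_convex_comb4 i j k p q (l * (1 - t)) (l * t) ((1 - l) * (1 - X i))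
  ((1 - l) * X i)) => //; rewrite ?Pp ?Pq /=.
- by apply: mulr_ge0; lra.
- by apply: mulr_ge0; lra.
- by apply: mulr_ge0; lra.
- by apply: mulr_ge0; lra.
- ring.
- transitivity (l * ((1 - t) * X j + t * X k) + (1 - l) * X i); first by ring.
  by rewrite -xE; ring.
- by rewrite -lS /S; ring.
Qed.

(** [p] and [q] belong to both chains. *)
Definition upper i := [|| i == p, i == q | 0 < Y i].

Lemma upper_p : upper p. Proof. by rewrite /upper eqxx. Qed.
Lemma upper_q : upper q. Proof. by rewrite /upper eqxx orbT. Qed.

Lemma upper_ge0 i : upper i -> 0 <= Y i.
Proof. by case/or3P => [/eqP->|/eqP->|/ltW//]; rewrite ?Pp ?Pq. Qed.

Lemma upper_gt0 i : upper i -> 0 < X i -> X i < 1 -> 0 < Y i.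
Proof. by case/or3P => [/eqP->|/eqP->|//]; rewrite ?Pp ?Pq /= ltxx. Qed.

Lemma upper_X0 i : upper i -> X i = 0 -> i = p.
Proof.
case/or3P => [/eqP->//|/eqP->|h]; first by rewrite Pq /= => h; exfalso; lra.
by have := abscissa_interior (lt0r_neq0 h) => h1 h2; exfalso; lra.
Qed.

Lemma upper_X1 i : upper i -> X i = 1 -> i = q.
Proof.
case/or3P => [/eqP->|/eqP->//|h]; first by rewrite Pp /= => h; exfalso; lra.
by have := abscissa_interior (lt0r_neq0 h) => h1 h2; exfalso; lra.
Qed.

(** Of two points with equal abscissa, the lower one would be on or below the degenerate chord at
    the other. *)
Lemma upper_X_inj i j : upper i -> upper j -> X i = X j -> i = j.
Proof.
move=> ui uj xE.
have /andP[] := abscissa_ge0_le1 i; rewrite !le_eqVlt.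
case/predU1P => [x0 _|x0]; first by rewrite (upper_X0 ui) // (upper_X0 uj) -?xE.
case/predU1P => [x1|x1]; first by rewrite (upper_X1 ui) // (upper_X1 uj) -?xE.
have yi := upper_gt0 ui x0 x1.
have yj : 0 < Y j by apply: (upper_gt0 uj); rewrite -xE.
apply/eqP/negPn/negP => ij.
case: (lerP (Y i) (Y j)) => h.
  have := @not_below_chord i j j 0 yi; rewrite eq_sym ij xE => /(_ isT isT); lra.
have := @not_below_chord j i i 0 yj; rewrite ij xE => /(_ isT isT); lra.
Qed.

Lemma upper_concave i j k : upper i -> upper j -> upper k -> X i < X j -> X j < X k ->
  (Y k - Y i) * (X j - X i) < (Y j - Y i) * (X k - X i).
Proof.
move=> ui uj uk ij jk.
have /andP[xi _] := abscissa_ge0_le1 i; have /andP[_ xk] := abscissa_ge0_le1 k.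
have yj : 0 < Y j by apply: upper_gt0 => //; lra.
pose t := (X j - X i) / (X k - X i).
have d0 : 0 < X k - X i by lra.
have tE : t * (X k - X i) = X j - X i by rewrite /t divfK // gt_eqF.
have t0 : 0 <= t by rewrite divr_ge0 //; lra.
have t1 : t <= 1 by rewrite ler_pdivrMr //; lra.
have ji : i != j by apply: contraTneq ij => ->; rewrite ltxx.
have jk' : k != j by apply: contraTneq jk => ->; rewrite ltxx.
have := @not_below_chord j i k t yj ji jk'; rewrite t0 t1 => /(_ isT).
have -> : X j = (1 - t) * X i + t * X k by rewrite -[X j](subrK (X i)) -tE; ring.
move=> /(_ erefl) h; rewrite -subr_gt0.
have : 0 < (X k - X i) * (Y j - ((1 - t) * Y i + t * Y k)) by rewrite mulr_gt0 // subr_gt0.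
lra.
Qed.

Lemma upper_angle i j k : upper i -> upper j -> upper k -> X i < X j -> X j < X k ->
  angle (P j) (P k) <= angle (P i) (P j).
Proof.
move=> ui uj uk ij jk; apply: le_atan.
have := upper_concave ui uj uk ij jk => h.
rewrite ler_pdivrMr ?subr_gt0 // mulrAC ler_pdivlMr ?subr_gt0 //; lra.
Qed.

Definition X_lt := [rel i j | X i < X j].

Lemma X_lt_last u s i : path X_lt u s -> i \in u :: s -> i = last u s \/ X i < X (last u s).
Proof.
elim: s u i => [|v s IH] u i /=; first by rewrite inE => _ /eqP; left.
case/andP=> uv pv; rewrite inE => /predU1P[->|/(IH _ _ pv)//]; right.
by case: (IH v v pv (mem_head _ _)) => [<-//|]; exact: lt_trans.
Qed.

Lemma X_lt_head u s i : path X_lt u s -> i \in s -> X u < X i.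
Proof.
move=> ps; apply/allP: i; apply: (order_path_min (leT := X_lt)) => //.
by move=> ? ? ?; apply: lt_trans.
Qed.

(** The induction keeps [hi] above the angles from the current point to all later ones; by concavity
    the direction of the edge just passed is such a bound again. *)
Lemma upper_turns_right lo hi u s :
  path X_lt u s -> all upper (u :: s) -> lo <= hi ->
  (forall j, j \in s -> angle (P u) (P j) <= hi) ->
  (forall i j, i \in u :: s -> j \in u :: s -> X i < X j -> lo <= angle (P i) (P j)) ->
  turns_right P lo hi u s.
Proof.
elim: s u hi => [//|v s IH] u hi /= /andP[uv pv] /and3P[Uu Uv Us] lohi H1 H2.
split=> //; first by apply: H1; exact: mem_head.
apply: IH => //=; first by rewrite Uv.
- by apply: H2; rewrite ?inE ?eqxx ?orbT.
- move=> j js; apply: upper_angle => //; first exact: (allP Us).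
  exact: (X_lt_head pv).
- by move=> i j iv jv; apply: H2; rewrite inE ?iv ?jv orbT.
Qed.

Lemma upper_chain_stretch u s :
  path X_lt u s -> all upper (u :: s) ->
  walk_length P u s <= 2 * pi / 3 * edist (P u) (P (last u s)).
Proof.
move=> ps Us; set v := last u s.
have Uin i : i \in u :: s -> upper i by move/(allP Us).
have Uu : upper u by apply: Uin; exact: mem_head.
have Uv : upper v by apply: Uin; exact: mem_last.
have p0 := @pi_gt0 R.
have xpos i : i != p -> upper i -> 0 < X i.
  move=> ip ui; rewrite lt_neqAle; have /andP[-> _] := abscissa_ge0_le1 i.
  by rewrite andbT; apply: contraNneq ip => h; rewrite (upper_X0 ui).
have xlt1 i : i != q -> upper i -> X i < 1.
  move=> iq ui; rewrite lt_neqAle; have /andP[_ ->] := abscissa_ge0_le1 i.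
  by rewrite andbT; apply: contraNneq iq => h; rewrite (upper_X1 ui).
have [phi [r [phi0 r0 Pu Hphi Hbelow]]] : exists phi r, [/\ 0 <= phi <= pi / 2, 0 <= r,
    P u = (r * cos phi, r * sin phi),
    forall j, j \in s -> angle (P u) (P j) <= phi &
    forall i, i \in u :: s -> Y i * cos phi - X i * sin phi <= 0].
  have [->|up] := eqVneq u p.
    (* At [u = p] the vertical direction bounds all angles, and all points are to its right. *)
    exists (pi / 2), 0; rewrite Pp !mul0r; split=> //; first by lra.
      by move=> j _; have := angle_bounds (0, 0) (P j); lra.
    move=> i _; rewrite cos_pihalf sin_pihalf.
    by have := abscissa_ge0_le1 i; lra.
  have xu := xpos _ up Uu.
  have pu : (P p).1 < (P u).1 by rewrite Pp.
  have [e1 e2] := angleE pu; exists (angle (P p) (P u)), (edist (P p) (P u)).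
  have {}e1 : X u = edist (P p) (P u) * cos (angle (P p) (P u)).
    by rewrite -e1 Pp subr0.
  have {}e2 : Y u = edist (P p) (P u) * sin (angle (P p) (P u)).
    by rewrite -e2 Pp subr0.
  have r0 : 0 < edist (P p) (P u).
    rewrite lt_neqAle sqrtr_ge0 andbT; apply: contraTneq xu => h.
    by rewrite e1 -h mul0r ltxx.
  split; first last.
  - move=> i iu; rewrite -(pmulr_rle0 _ r0).
    rewrite (_ : edist (P p) (P u) * _ = Y i * X u - X i * Y u); last by rewrite e1 e2; ring.
    move: iu; rewrite inE => /predU1P[->|iS]; first by lra.
    have := upper_concave upper_p Uu (Uin i _) pu (X_lt_head ps iS).
    by rewrite inE iS orbT Pp /= !subr0 => /(_ isT); lra.
  - move=> j js; apply: upper_angle => //; first exact: upper_p.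
      by apply: Uin; rewrite inE js orbT.
    exact: (X_lt_head ps).
  - by rewrite -e1 -e2; case: (P u).
  - exact: ltW.
  - apply/andP; split; last by have := angle_bounds (P p) (P u); lra.
    rewrite -(atan0 R); apply: le_atan; rewrite Pp /= !subr0.
    by rewrite divr_ge0 ?upper_ge0 // ltW.
have [psi [t [psi0 t0 Pv Hpsi Hbelow']]] : exists psi t, [/\ 0 <= psi <= pi / 2, 0 <= t,
    P v = (1 - t * cos psi, t * sin psi),
    forall i j, i \in u :: s -> j \in u :: s -> X i < X j -> - psi <= angle (P i) (P j) &
    forall i, i \in u :: s -> (X i - 1) * sin psi + Y i * cos psi <= 0].
  have [->|vq] := eqVneq v q.
    exists (pi / 2), 0; rewrite Pq !mul0r subr0; split=> //; first by lra.
      by move=> i j _ _ _; have := angle_bounds (P i) (P j); lra.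
    move=> i _; rewrite cos_pihalf sin_pihalf.
    by have := abscissa_ge0_le1 i; lra.
  have xv := xlt1 _ vq Uv.
  have vq1 : (P v).1 < (P q).1 by rewrite Pq.
  (* The segment from [v] to [q] does not ascend, hence the sign. *)
  have [e1 e2] := angleE vq1; exists (- angle (P v) (P q)), (edist (P v) (P q)).
  have {}e1 : 1 - X v = edist (P v) (P q) * cos (angle (P v) (P q)).
    by rewrite -e1 Pq.
  have {}e2 : - Y v = edist (P v) (P q) * sin (angle (P v) (P q)).
    by rewrite -e2 Pq sub0r.
  have t0 : 0 < edist (P v) (P q).
    rewrite lt_neqAle sqrtr_ge0 andbT; apply: contraTneq xv => h.
    by move: e1; rewrite -h mul0r; lra.
  rewrite cosN sinN opprK; split; first last.
  - move=> i iu; rewrite -(pmulr_rle0 _ t0).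
    rewrite (_ : edist (P v) (P q) * _ = (X i - 1) * Y v + Y i * (1 - X v)); last first.
      by rewrite e1 -[Y v]opprK e2; ring.
    case: (X_lt_last ps iu) => [->|lt_iv]; first by rewrite -/v; lra.
    have := upper_concave (Uin i iu) Uv upper_q lt_iv vq1.
    by rewrite Pq /=; lra.
  - move=> i j iu ju ij; case: (X_lt_last ps ju) => [jE|jv].
      move: ij; rewrite jE -/v => ij.
      exact: (upper_angle (Uin _ iu) Uv upper_q ij vq1).
    apply: (le_trans (upper_angle (Uin _ ju) Uv upper_q jv vq1)).
    exact: (upper_angle (Uin _ iu) (Uin _ ju) Uv ij jv).
  - by rewrite mulrN -e1 -e2; case: (P v) => a b /=; congr pair; ring.
  - exact: ltW.
  - apply/andP; split; last by have := angle_bounds (P v) (P q); lra.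
    rewrite oppr_ge0 -(atan0 R); apply: le_atan; rewrite Pq /= sub0r.
    rewrite mulNr oppr_le0 divr_ge0 ?upper_ge0 // subr_ge0 ltW //.
apply: (@chain_stretch R n P u s phi psi r t) => //.
  by apply: upper_turns_right => //; lra.
by move=> i iu; split; rewrite ?Hbelow ?Hbelow'.
Qed.

(** Twice the signed area of the triangle, positive for [x] to the left of the line from [a] to
    [b]. *)
Definition cross (a b x : R * R) : R :=
  (b.1 - a.1) * (x.2 - a.2) - (b.2 - a.2) * (x.1 - a.1).

(** By concavity neither [p] nor [q] is above the line; [P k] is strictly below a point of the
    segment [pq]. *)
Lemma below_upper_line i j k : upper i -> upper j -> X i < X j -> Y k < 0 ->
  cross (P i) (P j) (P k) < 0.
Proof.
move=> ui uj ij yk; have /andP[k0 k1] := abscissa_ge0_le1 k.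
have /andP[i0 _] := abscissa_ge0_le1 i; have /andP[_ j1] := abscissa_ge0_le1 j.
have cp : cross (P i) (P j) (0, 0) <= 0.
  rewrite -Pp; move: i0; rewrite le_eqVlt => /predU1P[x0|x0].
    by rewrite (upper_X0 ui) // /cross; lra.
  have := upper_concave upper_p ui uj; rewrite Pp => /(_ x0 ij).
  by rewrite /cross /=; lra.
have cq : cross (P i) (P j) (1, 0) <= 0.
  rewrite -Pq; move: j1; rewrite le_eqVlt => /predU1P[x1|x1].
    by rewrite (upper_X1 uj) // /cross; lra.
  have := upper_concave ui uj upper_q ij; rewrite Pq => /(_ x1).
  by rewrite /cross /=; lra.
have -> : cross (P i) (P j) (P k) = (1 - X k) * cross (P i) (P j) (0, 0)
  + X k * cross (P i) (P j) (1, 0) + (X j - X i) * Y k.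
  by rewrite /cross /=; ring.
have h1 : 0 <= (1 - X k) * - cross (P i) (P j) (0, 0) by apply: mulr_ge0; lra.
have h2 : 0 <= X k * - cross (P i) (P j) (1, 0) by apply: mulr_ge0; lra.
have h3 : 0 < (X j - X i) * - Y k by apply: mulr_gt0; lra.
lra.
Qed.

Definition upper_succ := [rel i j | [&& upper i, upper j, X i < X j &
  [forall k, upper k ==> ~~ (X i < X k < X j)]]].

Lemma upper_succ_lt i j : upper_succ i j -> X i < X j.
Proof. by case/and4P. Qed.

(** No other chain point has its abscissa between those of [i] and [j], and outside this range
    concavity puts the chain below the line. The remaining points are below [pq]. *)
Lemma upper_succ_line i j k : upper_succ i j -> k != i -> k != j ->
  cross (P i) (P j) (P k) < 0.
Proof.
case/and4P=> ui uj ij /forallP between ki kj.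
have [uk|] := boolP (upper k); last first.
  rewrite !negb_or => /and3P[kp kq]; rewrite -leNgt => yk.
  by apply: below_upper_line => //; rewrite lt_neqAle yk ordinate_neq0.
have := between k; rewrite uk /=; case: (ltgtP (X i) (X k)) => //= [ik|ik _|].
- case: (ltgtP (X k) (X j)) => //= [jk _|/(upper_X_inj uk uj)/eqP]; last first.
    by rewrite (negPf kj).
  by have := upper_concave ui uj uk ij jk; rewrite /cross; lra.
- by have := upper_concave uk ui uj ik ij; rewrite /cross; lra.
- by move/(upper_X_inj ui uk)/eqP; rewrite eq_sym (negPf ki).
Qed.

Lemma upper_succ_inj i j k : upper_succ i j -> upper_succ i k -> j = k.
Proof.
case/and4P=> ui uj ij /forallP bj /and4P[_ uk ik /forallP bk].
apply: upper_X_inj => //; apply: le_anti; rewrite !leNgt.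
have := bj k; have := bk j; rewrite uj uk ij ik /= => -> ->.
by [].
Qed.

Lemma upper_pred_inj i j k : upper_succ j i -> upper_succ k i -> j = k.
Proof.
case/and4P=> uj ui ji /forallP bj /and4P[uk _ ki /forallP bk].
apply: upper_X_inj => //; apply: le_anti; rewrite !leNgt.
have := bj k; have := bk j; rewrite uj uk ji ki /= !andbT => -> ->.
by [].
Qed.

(** Go to the leftmost later point; the number of later points drops. *)
Lemma upper_succ_path u v : upper u -> upper v -> X u <= X v ->
  exists2 s, path upper_succ u s & last u s = v.
Proof.
move=> uu uv.
have [m] := ubnP #|[pred k | upper k && (X u < X k)]|.
elim: m u uu => // m IH u uu cm; rewrite le_eqVlt => /predU1P[xE|lt].
  by exists [::] => //; apply: upper_X_inj.
pose later := [pred k | upper k && (X u < X k)].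
have Pv : later v by rewrite /= uv.
case: (arg_minP (fun k => X k) Pv) => w /andP[uw xuw] wmin.
have sw : upper_succ u w.
  rewrite /= uu uw xuw; apply/forallP => k; apply/implyP => uk.
  by apply/negP => /andP[uk' kw]; have /wmin : later k by [rewrite /= uk]; rewrite leNgt kw.
have [||s ps ls] := IH w uw; last first.
- by exists (w :: s) => //; apply/andP; split; [exact: sw | exact: ps].
- by apply: wmin.
- rewrite -ltnS; apply: leq_trans cm; rewrite ltnS; apply: proper_card.
  apply/properP; split.
    by apply/subsetP => k; rewrite !inE => /andP[-> /(lt_trans xuw)].
  by exists w; rewrite !inE ?uw ?xuw ?ltxx.
Qed.

Lemma upper_dG_le (E : rel 'I_n) u v : symmetric E -> subrel upper_succ E ->
  upper u -> upper v -> dG_le P E u v (2 * pi / 3 * edist (P u) (P v)).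
Proof.
move=> symE subE.
wlog le_uv : u v / X u <= X v => [hw|] uu uv.
  case: (leP (X u) (X v)) => [|/ltW] h; first exact: hw.
  by rewrite edistC; apply: dG_le_sym => //; apply: hw.
have [s ps ls] := upper_succ_path uu uv le_uv.
exists s; split=> //; first by apply: sub_path ps.
rewrite -ls; apply: upper_chain_stretch.
  by apply: sub_path ps => i j /upper_succ_lt.
elim: s u {le_uv ls} uu ps => [|w s IH] u uu /=; first by rewrite uu.
by case/andP => /and4P[_ uw _ _] /(IH w uw) /= ->; rewrite uu.
Qed.
End UpperChain.

(** * The matching *)

(* Add a closest pair [(a, b)] and recurse separately on the points to the left
   and on the points to the right of [a] and [b]; a pair [(u, v)] is then separated
   by the closest pair of the last recursive call containing it. *)
Lemma monotone_matching (R : realType) (T : finType) (X : T -> R) (d : T -> T -> R)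
    (A B : {set T}) :
  exists M : {set T * T},
  [/\ forall e, e \in M -> e.1 \in A /\ e.2 \in B,
      forall e f, e \in M -> f \in M ->
        [\/ e = f, X e.1 < X f.1 /\ X e.2 < X f.2 | X f.1 < X e.1 /\ X f.2 < X e.2] &
      forall u v, u \in A -> v \in B -> exists2 e, e \in M & d e.1 e.2 <= d u v /\
        ((X u <= X e.1 /\ X e.2 <= X v) \/ (X e.1 <= X u /\ X v <= X e.2))].
Proof.
have [m] := ubnP #|A|; elim: m A B => // m IH A B cA.
have [->|[a0 a0A]] := set_0Vmem A.
  by exists set0; split=> [e|e f|u v]; rewrite ?inE.
have [->|[b0 b0B]] := set_0Vmem B.
  by exists set0; split=> [e|e f|u v]; rewrite ?inE.
pose cand := [pred e : T * T | (e.1 \in A) && (e.2 \in B)].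
have c0 : cand (a0, b0) by rewrite /= a0A.
case: (arg_minP (fun e : T * T => d e.1 e.2) c0) => -[a b] /andP[/= aA bB] ab_min.
have card_lt (Q : pred T) : ~~ Q a -> (#|[set x in A | Q x]| < m)%N.
  move=> Qa; rewrite -ltnS; apply: leq_trans cA; rewrite ltnS; apply: proper_card.
  apply/properP; split; first by apply/subsetP => x; rewrite inE => /andP[].
  by exists a; rewrite // inE aA.
have [|M1 [sub1 mono1 sep1]] :=
  IH [set x in A | X x < X a] [set x in B | X x < X b].
  by apply: card_lt; rewrite ltxx.
have [|M2 [sub2 mono2 sep2]] :=
  IH [set x in A | X a < X x] [set x in B | X b < X x].
  by apply: card_lt; rewrite ltxx.
have left e : e \in M1 -> [/\ e.1 \in A, e.2 \in B, X e.1 < X a & X e.2 < X b].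
  by case/sub1; rewrite !inE => /andP[-> ->] /andP[-> ->].
have right e : e \in M2 -> [/\ e.1 \in A, e.2 \in B, X a < X e.1 & X b < X e.2].
  by case/sub2; rewrite !inE => /andP[-> ->] /andP[-> ->].
exists ((a, b) |: (M1 :|: M2)); split.
- move=> e; rewrite !inE => /or3P[/eqP->//|/left[]|/right[]] //.
- move=> e f; rewrite !inE.
  case/or3P=> [/eqP->|e1|e2] /or3P[/eqP->|f1|f2] /=.
  + by constructor 1.
  + by case: (left _ f1); constructor 3.
  + by case: (right _ f2); constructor 2.
  + by case: (left _ e1); constructor 2.
  + exact: mono1.
  + have [_ _ e3 e4] := left _ e1; have [_ _ f3 f4] := right _ f2.
    by constructor 2; split; [apply: lt_trans f3 | apply: lt_trans f4].
  + by case: (right _ e2); constructor 3.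
  + have [_ _ f3 f4] := left _ f1; have [_ _ e3 e4] := right _ e2.
    by constructor 3; split; [apply: lt_trans e3 | apply: lt_trans e4].
  + exact: mono2.
- move=> u v uA vB.
  have closest : (exists2 e, e \in [set (a, b)] & d e.1 e.2 <= d u v /\
      ((X u <= X e.1 /\ X e.2 <= X v) \/ (X e.1 <= X u /\ X v <= X e.2))) ->
    exists2 e, e \in (a, b) |: (M1 :|: M2) & d e.1 e.2 <= d u v /\
      ((X u <= X e.1 /\ X e.2 <= X v) \/ (X e.1 <= X u /\ X v <= X e.2)).
    by case=> e; rewrite inE => eab H; exists e; rewrite // !inE eab.
  have dab : d a b <= d u v by apply: (ab_min (u, v)); rewrite /= uA.
  case: (ltgtP (X u) (X a)) => ua; case: (lerP (X v) (X b)) => vb.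
  + move: vb; rewrite le_eqVlt => /predU1P[vb|vb].
      apply: closest; exists (a, b); rewrite ?inE //; split=> //; left.
      by rewrite vb; split=> //; exact: ltW.
    have [||e eM H] := sep1 u v; rewrite ?inE ?uA ?vB //.
    by exists e; rewrite // !inE eM orbT.
  + apply: closest; exists (a, b); rewrite ?inE //; split=> //; left.
    by split; exact: ltW.
  + apply: closest; exists (a, b); rewrite ?inE //; split=> //; right.
    by split=> //; exact: ltW.
  + have [||e eM H] := sep2 u v; rewrite ?inE ?uA ?vB //.
    by exists e; rewrite // !inE eM !orbT.
  + apply: closest; exists (a, b); rewrite ?inE //; split=> //; right.
    by rewrite ua; split.
  + apply: closest; exists (a, b); rewrite ?inE //; split=> //; left.
    by rewrite ua; split=> //; exact: ltW.
Qed.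

(** * Planarity *)

Section Segments.
Variable R : realType.
Implicit Types a b u v x : R * R.

Lemma cross_on_segment a b u v x : on_segment u v x ->
  exists2 t, 0 <= t <= 1 & cross a b x = (1 - t) * cross a b u + t * cross a b v.
Proof. by case=> t [t01 ->]; exists t => //; rewrite /cross /=; ring. Qed.

Lemma cross_segment_self a b x : on_segment a b x -> cross a b x = 0.
Proof. by case/(cross_on_segment a b) => t _ ->; rewrite /cross; ring. Qed.

(** The signs make the segments [uv] and [ab] cross at a point [z], found from ratios of signed
    areas; the triangle inequalities through [z] are then added. *)
Lemma crossing_segments a b u v :
  cross a b u < 0 -> 0 < cross a b v -> 0 < cross u v a -> cross u v b < 0 ->
  edist u a + edist b v <= edist u v + edist a b.
Proof.
move=> h1 h2 h3 h4.
pose s := - cross a b u / (cross a b v - cross a b u).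
pose t := cross u v a / (cross u v a - cross u v b).
have s01 : 0 <= s <= 1.
  apply/andP; split; first by apply: divr_ge0; lra.
  by rewrite ler_pdivrMr; lra.
have t01 : 0 <= t <= 1.
  apply/andP; split; first by apply: divr_ge0; lra.
  by rewrite ler_pdivrMr; lra.
pose z : R * R := (u.1 + s * (v.1 - u.1), u.2 + s * (v.2 - u.2)).
have zuv : on_segment u v z by exists s.
have zab : on_segment a b z.
  exists t; split=> //; rewrite /z /s /t /cross in h1 h2 h3 h4 *.
  by congr pair; field; lra.
have e1 := edist_on_segment zuv; have e2 := edist_on_segment zab.
have := edist_triangle u a z; have := edist_triangle b v z.
by rewrite (edistC b z) (edistC z a); lra.
Qed.

Variables (n : nat) (P : 'I_n -> R * R).
Implicit Types i j k l m : 'I_n.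

(** [cross] is affine along the edge [kl] and vanishes at [x], while it has a strict sign at all
    points other than [P i] and [P j]; [sg] selects the side. *)
Lemma side_plane (sg : R) i j k l x :
  (forall m, m != i -> m != j -> sg * cross (P i) (P j) (P m) < 0) ->
  k != l -> ~ ((i == k) && (j == l) || (i == l) && (j == k)) ->
  on_segment (P i) (P j) x -> on_segment (P k) (P l) x ->
  (x = P i \/ x = P j) /\ (x = P k \/ x = P l).
Proof.
move=> side kl notsame xij xkl.
have c0 := cross_segment_self xij.
have [t [/andP[t0 t1] xE]] := xkl.
have lin : (1 - t) * (sg * cross (P i) (P j) (P k)) +
    t * (sg * cross (P i) (P j) (P l)) = 0.
  by rewrite -[RHS](mulr0 sg) -c0 xE /cross /=; ring.
have endp m : (m = i) \/ (m = j) \/ sg * cross (P i) (P j) (P m) < 0.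
  have [->|mi] := eqVneq m i; first by left.
  have [->|mj] := eqVneq m j; first by right; left.
  by right; right; apply: side.
have endp0 m : sg * cross (P i) (P j) (P m) <= 0.
  case: (endp m) => [->|[->|/ltW//]]; rewrite /cross; lra.
have xk : t = 0 -> x = P k.
  by move=> tE; rewrite xE tE !mul0r !addr0; case: (P k).
have xl : t = 1 -> x = P l.
  by move=> tE; rewrite xE tE !mul1r; case: (P l) => ? ?; congr pair => /=; ring.
have k0 : sg * cross (P i) (P j) (P k) < 0 -> x = P l.
  move=> ck; apply: xl; have := endp0 l => cl.
  have : 0 <= t * - (sg * cross (P i) (P j) (P l)) by apply: mulr_ge0; lra.
  case: (ltP t 1) => [tlt|]; last by lra.
  have : 0 < (1 - t) * - (sg * cross (P i) (P j) (P k)) by apply: mulr_gt0; lra.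
  lra.
have l0 : sg * cross (P i) (P j) (P l) < 0 -> x = P k.
  move=> cl; apply: xk; have := endp0 k => ck.
  have : 0 <= (1 - t) * - (sg * cross (P i) (P j) (P k)) by apply: mulr_ge0; lra.
  case: (ltP 0 t) => [tlt|]; last by lra.
  have : 0 < t * - (sg * cross (P i) (P j) (P l)) by apply: mulr_gt0; lra.
  lra.
have ends m : x = P m -> m = i \/ m = j -> x = P i \/ x = P j.
  by move=> -> [->|->]; [left|right].
case: (endp k) => [kE|[kE|/[dup] ck /k0 xlE]]; last first.
- split; last by right.
  case: (endp l) => [lE|[lE|cl]]; [by apply: (ends l); auto..|exfalso].
  have : 0 <= (1 - t) * - (sg * cross (P i) (P j) (P k)) by apply: mulr_ge0; lra.
  have : 0 <= t * - (sg * cross (P i) (P j) (P l)) by apply: mulr_ge0; lra.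
  case: (ltP 0 t) => tlt.
    have : 0 < t * - (sg * cross (P i) (P j) (P l)) by apply: mulr_gt0; lra.
    lra.
  have : 0 < (1 - t) * - (sg * cross (P i) (P j) (P k)) by apply: mulr_gt0; lra.
  lra.
all: case: (endp l) => [lE|[lE|/l0 xkE]];
  try by split; [apply: (ends k); auto | left].
all: exfalso; (try by move: kl; rewrite kE lE eqxx); apply: notsame;
  by rewrite kE lE !eqxx ?orbT.
Qed.
End Segments.

Lemma card_le3 (T : finType) (A B1 B2 B3 : pred T) :
  (forall x, A x -> [\/ B1 x, B2 x | B3 x]) ->
  (forall x y, B1 x -> B1 y -> x = y) -> (forall x y, B2 x -> B2 y -> x = y) ->
  (forall x y, B3 x -> B3 y -> x = y) -> (#|[pred x | A x]| <= 3)%N.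
Proof.
move=> AB h1 h2 h3.
have card1 (B : pred T) : (forall x y, B x -> B y -> x = y) -> (#|B| <= 1)%N.
  by move=> h; apply/card_le1_eqP => x y xB yB; apply: h.
have sub : [pred x | A x] \subset predU B1 (predU B2 B3).
  apply/subsetP => x; rewrite !inE => /AB[] h; apply/or3P.
  - by constructor 1.
  - by constructor 2.
  - by constructor 3.
apply: leq_trans (subset_leq_card sub) _.
have h23 : (#|predU B2 B3| <= 2)%N.
  by rewrite -[2%N]/(1 + 1)%N (leq_trans _ (leq_add (card1 _ h2) (card1 _ h3))) //
    -cardUI leq_addr.
by rewrite -[3%N]/(1 + 2)%N (leq_trans _ (leq_add (card1 _ h1) h23)) // -cardUI leq_addr.
Qed.

(** Weights of sum 1 commute with affine maps. This serves both the reflection in [pq] and the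
    normalizing similarity. *)
Lemma convex_position_affine (R : realType) (n : nat) (P Q : 'I_n -> R * R)
    (o1 o2 a b c d : R) :
  (forall i, P i = (o1 + a * (Q i).1 + b * (Q i).2, o2 + c * (Q i).1 + d * (Q i).2)) ->
  convex_position P -> convex_position Q.
Proof.
move=> PE convP i [w [w0 [wi [w1 [wX wY]]]]]; apply: (convP i); exists w.
do 3![split=> //].
have comb o e f : \sum_j w j * (o + e * (Q j).1 + f * (Q j).2) =
    o + e * (Q i).1 + f * (Q i).2.
  under eq_bigr do rewrite !mulrDr mulrCA [w _ * (f * _)]mulrCA.
  by rewrite !big_split /= -mulr_suml w1 mul1r -!mulr_sumr wX wY.
by split; rewrite PE /= -comb; apply: eq_bigr => j _; rewrite PE.
Qed.

(** * The spanner *)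

Section NormalizedSpanner.
Variables (R : realType) (n : nat) (P : 'I_n -> R * R) (p q : 'I_n).
Hypothesis convP : convex_position P.
Hypotheses (Pp : P p = (0, 0)) (Pq : P q = (1, 0)).
Hypothesis luneP : forall i, in_lune (P i).
Notation X i := (P i).1.
Notation Y i := (P i).2.
Implicit Types i j k u v a b : 'I_n.

(** The reflection in the line [pq], by which the results on upper chains apply to the lower
    chain. *)
Let Q i : R * R := (X i, - Y i).

Let convQ : convex_position Q.
Proof.
apply: (@convex_position_affine R n P Q 0 0 1 0 0 (-1)) convP => i.
by rewrite [LHS]surjective_pairing /=; congr pair; ring.
Qed.

Let Qp : Q p = (0, 0). Proof. by rewrite /Q Pp /= oppr0. Qed.
Let Qq : Q q = (1, 0). Proof. by rewrite /Q Pq /= oppr0. Qed.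

Let luneQ i : in_lune (Q i).
Proof. by have [h1 h2] := luneP i; split; rewrite /Q /= sqrrN. Qed.

Let edistQ i j : edist (Q i) (Q j) = edist (P i) (P j).
Proof. by congr Num.sqrt; rewrite /=; ring. Qed.

Let crossQ i j k : cross (Q i) (Q j) (Q k) = - cross (P i) (P j) (P k).
Proof. by rewrite /cross /=; ring. Qed.

Let walkQ u s : walk_length Q u s = walk_length P u s.
Proof. by elim: s u => //= v s IH u; rewrite edistQ IH. Qed.

Let lowerE i : upper Q p q i = [|| i == p, i == q | Y i < 0].
Proof. by rewrite /upper /Q /= oppr_gt0. Qed.

Let up_low u1 u2 b : upper P p q u1 -> upper P p q u2 -> X u1 < X u2 -> Y b < 0 ->
  cross (P u1) (P u2) (P b) < 0.
Proof. exact: below_upper_line. Qed.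

Let low_up l1 l2 a : upper Q p q l1 -> upper Q p q l2 -> X l1 < X l2 -> 0 < Y a ->
  0 < cross (P l1) (P l2) (P a).
Proof.
move=> h1 h2 h3 h4; rewrite -oppr_lt0 -crossQ.
by apply: (below_upper_line convQ Qp Qq luneQ h1 h2 h3); rewrite /Q /= oppr_lt0.
Qed.

Let up_of a : 0 < Y a -> upper P p q a. Proof. by rewrite /upper => ->; rewrite !orbT. Qed.
Let low_of b : Y b < 0 -> upper Q p q b. Proof. by rewrite lowerE => ->; rewrite !orbT. Qed.

(** The line [ua] has [b] and [v] below it and the line [bv] has [u] and [a] above it, so the
    diagonals [uv] and [ab] cross. If [u = a] or [b = v], this is a triangle inequality. *)
Let quadrilateral u a b v : 0 < Y u -> 0 < Y a -> Y b < 0 -> Y v < 0 ->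
  X u <= X a -> X b <= X v ->
  edist (P u) (P a) + edist (P b) (P v) <= edist (P u) (P v) + edist (P a) (P b).
Proof.
move=> yu ya yb yv; rewrite le_eqVlt => /predU1P[ua|ua].
  have -> : u = a by apply: (upper_X_inj convP Pp Pq luneP (up_of yu) (up_of ya) ua).
  have -> : edist (P a) (P a) = 0 by rewrite /edist !subrr expr0n /= addr0 sqrtr0.
  by have := edist_triangle (P b) (P v) (P a); rewrite (edistC (P b) (P a)); lra.
rewrite le_eqVlt => /predU1P[bv|bv].
  have -> : b = v by apply: (upper_X_inj convQ Qp Qq luneQ (low_of yb) (low_of yv) bv).
  have -> : edist (P v) (P v) = 0 by rewrite /edist !subrr expr0n /= addr0 sqrtr0.
  by have := edist_triangle (P u) (P a) (P v); rewrite (edistC (P v) (P a)); lra.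
have c1 := up_low (up_of yu) (up_of ya) ua yb.
have c2 := up_low (up_of yu) (up_of ya) ua yv.
have c3 := low_up (low_of yb) (low_of yv) bv yu.
have c4 := low_up (low_of yb) (low_of yv) bv ya.
apply: crossing_segments; move: c1 c2 c3 c4; rewrite /cross; lra.
Qed.

(** Both ends of the second segment lie strictly to the right of the first. *)
Let disjoint_rungs a b a' b' x : 0 < Y a -> 0 < Y a' -> Y b < 0 -> Y b' < 0 ->
  X a < X a' -> X b < X b' ->
  on_segment (P a) (P b) x -> on_segment (P a') (P b') x -> False.
Proof.
move=> ya ya' yb yb' aa bb xab /(cross_on_segment (P a) (P b))[t /andP[t0 t1]].
rewrite cross_segment_self // => e.
have c1 := up_low (up_of ya) (up_of ya') aa yb.
have c2 := low_up (low_of yb) (low_of yb') bb ya.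
have d1 : 0 < cross (P a) (P b) (P a') by move: c1; rewrite /cross; lra.
have d2 : 0 < cross (P a) (P b) (P b') by move: c2; rewrite /cross; lra.
have h1 : 0 <= (1 - t) * cross (P a) (P b) (P a') by apply: mulr_ge0; lra.
have h2 : 0 <= t * cross (P a) (P b) (P b') by apply: mulr_ge0; lra.
case: (ltP 0 t) => tlt.
  have : 0 < t * cross (P a) (P b) (P b') by apply: mulr_gt0; lra.
  lra.
have : 0 < (1 - t) * cross (P a) (P b) (P a') by apply: mulr_gt0; lra.
lra.
Qed.

Lemma normalized_spanner : exists E : rel 'I_n,
  [/\ simple_graph E, plane P E,
      stretch_at_most P E ((3 + 4 * pi) / 3) & max_degree_le E 3].
Proof.
pose A := [set i | 0 < Y i]; pose B := [set i | Y i < 0].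
have [M [subM monoM sepM]] :=
  monotone_matching (fun i => X i) (fun i j => edist (P i) (P j)) A B.
have MY i j : (i, j) \in M -> 0 < Y i /\ Y j < 0.
  by move/subM; rewrite !inE.
pose U := upper_succ P p q; pose L := upper_succ Q p q.
pose hull := [rel i j | [|| U i j, U j i, L i j | L j i]].
pose rung := [rel i j | ((i, j) \in M) || ((j, i) \in M)].
pose E := [rel i j | hull i j || rung i j].
have symhull : symmetric hull.
  by move=> i j; rewrite /=; do 4!case: (_ && _).
have symrung : symmetric rung by move=> i j; rewrite /= orbC.
have symE : symmetric E by move=> i j; congr (_ || _); [exact: symhull | exact: symrung].
have Ult i j : U i j -> X i < X j by apply: upper_succ_lt.
have Llt i j : L i j -> X i < X j by move/upper_succ_lt.
have irrE i : ~~ E i i.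
  rewrite /E /= -/(U i i) -/(L i i); apply/negP => h.
  have : [\/ U i i, L i i | (i, i) \in M].
    by case/orP: h => [/or4P[]|/orP[]] ?; by [constructor 1|constructor 2|constructor 3].
  case=> [/Ult|/Llt|/MY]; rewrite ?ltxx //; lra.
exists E; split.
- by split.
(* A chain edge has all other points strictly on one side, which settles its meetings with any edge;
   two distinct matched pairs are disjoint by monotonicity. *)
- have hull_plane i j k l : hull i j -> E k l ->
      ~ ((i == k) && (j == l) || (i == l) && (j == k)) ->
      forall x, on_segment (P i) (P j) x -> on_segment (P k) (P l) x ->
      (x = P i \/ x = P j) /\ (x = P k \/ x = P l).
    move=> hij Ekl ns x xij xkl.
    have kl : k != l by apply: contraTneq Ekl => ->; apply: irrE.
    have crossN u v w : cross (P v) (P u) (P w) = - cross (P u) (P v) (P w).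
      by rewrite /cross; ring.
    case/or4P: hij => h.
    + apply: (side_plane (sg := 1)) kl ns xij xkl => m mi mj; rewrite mul1r.
      exact: (upper_succ_line convP Pp Pq luneP h).
    + apply: (side_plane (sg := -1)) kl ns xij xkl => m mi mj; rewrite mulN1r -crossN.
      exact: (upper_succ_line convP Pp Pq luneP h).
    + apply: (side_plane (sg := -1)) kl ns xij xkl => m mi mj; rewrite mulN1r -crossQ.
      exact: (upper_succ_line convQ Qp Qq luneQ h).
    + apply: (side_plane (sg := 1)) kl ns xij xkl => m mi mj.
      rewrite mul1r crossN -crossQ.
      exact: (upper_succ_line convQ Qp Qq luneQ h).
  have segC a b x : on_segment (P a) (P b) x -> on_segment (P b) (P a) x.
    case=> t [/andP[t0 t1] ->]; exists (1 - t); split; first by lra.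
    by congr pair; ring.
  have rung_plane i j k l x : (i, j) \in M -> (k, l) \in M ->
      ~ ((i == k) && (j == l)) ->
      on_segment (P i) (P j) x -> on_segment (P k) (P l) x -> False.
    move=> m1 m2 ns; have [y1 y2] := MY _ _ m1; have [y3 y4] := MY _ _ m2.
    case: (monoM _ _ m1 m2) => [[ik jl]|[/= ik jl]|[/= ik jl]] h1 h2.
    + by apply: ns; rewrite ik jl !eqxx.
    + exact: (disjoint_rungs y1 y3 y2 y4 ik jl h1 h2).
    + exact: (disjoint_rungs y3 y1 y4 y2 ik jl h2 h1).
  move=> i j k l /orP[hij|rij] Ekl ns x xij xkl; first exact: (hull_plane i j k l).
  case/orP: Ekl => [hkl|rkl].
    have Eij : E i j by apply/orP; right.
    have ns' : ~ ((k == i) && (l == j) || (k == j) && (l == i)).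
      by move=> h; apply: ns; move: h; rewrite ![_ == i]eq_sym ![_ == j]eq_sym [(j == k) && _]andbC.
    by have [h1 h2] := hull_plane k l i j hkl Eij ns' x xkl xij; split.
  exfalso; case/orP: rij => m1; case/orP: rkl => m2.
  + by apply: (rung_plane i j k l x) => // h; apply: ns; rewrite h.
  + by apply: (rung_plane i j l k x) => // [h|]; [apply: ns; rewrite h orbT|exact: segC].
  + apply: (rung_plane j i k l x) => // [h|]; last exact: segC.
    by apply: ns; rewrite [(i == l) && _]andbC h orbT.
  + apply: (rung_plane j i l k x) => // [h||]; try exact: segC.
    by apply: ns; rewrite [(i == k) && _]andbC h.
- have c0 : 0 <= 2 * pi / 3 :> R by have := @pi_gt0 R; lra.
  have up_stretch u v : upper P p q u -> upper P p q v ->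
      dG_le P E u v (2 * pi / 3 * edist (P u) (P v)).
    apply: (upper_dG_le convP Pp Pq luneP) => // i j h.
    by apply/orP; left; apply/or4P; constructor 1.
  have low_stretch u v : upper Q p q u -> upper Q p q v ->
      dG_le P E u v (2 * pi / 3 * edist (P u) (P v)).
    move=> hu hv; rewrite -edistQ.
    have subL : subrel (upper_succ Q p q) E.
      by move=> i j h; apply/orP; left; apply/or4P; constructor 3.
    have [s [ps ls ws]] := upper_dG_le convQ Qp Qq luneQ symE subL hu hv.
    by exists s; split=> //; rewrite -walkQ.
  have rung_stretch u v : 0 < Y u -> Y v < 0 ->
      dG_le P E u v ((3 + 4 * pi) / 3 * edist (P u) (P v)).
    move=> yu yv; have [||[a b] abM [/= dab pos]] := sepM u v; rewrite ?inE //.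
    have [ya yb] := MY _ _ abM.
    have quad : edist (P u) (P a) + edist (P b) (P v) <=
        edist (P u) (P v) + edist (P a) (P b).
      (* In the other order, [u] is exchanged with [a] and [b] with [v]. *)
      case: pos => -[h1 h2]; first exact: quadrilateral.
      rewrite (edistC (P u) (P a)) (edistC (P b) (P v)) [leRHS]addrC.
      exact: quadrilateral.
    have Eab : E a b by apply/orP; right; apply/orP; left.
    apply: dG_le_weaken (dG_le_trans (up_stretch u a (up_of yu) (up_of ya))
      (dG_le_trans (dG_le_edge P Eab) (low_stretch b v (low_of yb) (low_of yv)))).
    (* With [c = 2 pi / 3], the factor [1 + 2 c] is [(3 + 4 pi) / 3]. *)
    have := ler_wpM2l c0 quad; have := ler_wpM2l c0 dab; lra.
  have weak u v : 2 * pi / 3 * edist (P u) (P v) <= (3 + 4 * pi) / 3 * edist (P u) (P v).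
    by rewrite ler_wpM2r ?edist_ge0 //; have := @pi_gt0 R; lra.
  have cover u : upper P p q u /\ upper Q p q u \/ 0 < Y u \/ Y u < 0.
    have [->|up] := eqVneq u p; first by left; rewrite !upper_p.
    have [->|uq] := eqVneq u q; first by left; rewrite !upper_q.
    have := ordinate_neq0 convP Pp Pq luneP up uq.
    by case: (ltgtP 0 (Y u)) => // _ _; right; [left|right].
  move=> u v.
  have chain : (upper P p q u /\ upper P p q v) \/ (upper Q p q u /\ upper Q p q v) ->
      dG_le P E u v ((3 + 4 * pi) / 3 * edist (P u) (P v)).
    by case=> -[h1 h2]; apply: dG_le_weaken (weak u v) _;
      [exact: up_stretch | exact: low_stretch].
  case: (cover u) => [[u1 u2]|[yu|yu]]; case: (cover v) => [[v1 v2]|[yv|yv]].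
  + by apply: chain; left.
  + by apply: chain; left; split=> //; exact: up_of.
  + by apply: chain; right; split=> //; exact: low_of.
  + by apply: chain; left; split=> //; exact: up_of.
  + by apply: chain; left; split; exact: up_of.
  + exact: rung_stretch.
  + by apply: chain; right; split=> //; exact: low_of.
  + by rewrite edistC; apply: dG_le_sym symE _; apply: rung_stretch.
  + by apply: chain; right; split; exact: low_of.
- move=> i.
  have Ui j k : U i j -> U i k -> j = k by apply: upper_succ_inj.
  have iU j k : U j i -> U k i -> j = k by apply: upper_pred_inj.
  have Li j k : L i j -> L i k -> j = k by apply: (upper_succ_inj convQ Qp Qq luneQ).
  have iL j k : L j i -> L k i -> j = k by apply: (upper_pred_inj convQ Qp Qq luneQ).
  (* Distinct matched pairs differ strictly in both abscissas, so they share no point. *)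
  have iM j k : (i, j) \in M -> (i, k) \in M -> j = k.
    by move=> h1 h2; case: (monoM _ _ h1 h2) => /= [[]|[]|[]] //; rewrite ltxx.
  have Mi j k : (j, i) \in M -> (k, i) \in M -> j = k.
    by move=> h1 h2; case: (monoM _ _ h1 h2) => /= [[]|[_]|[_]] //; rewrite ltxx.
  have Uup j k : U j k -> upper P p q j /\ upper P p q k by case/and4P.
  have Llow j k : L j k -> upper Q p q j /\ upper Q p q k by case/and4P.
  have cases j : E i j -> [\/ U i j, U j i, L i j | L j i] \/
      [\/ (i, j) \in M | (j, i) \in M].
    by case/orP => [/or4P h|/orP h]; [left|right].
  (* [p] and [q] are unmatched and have at most one neighbour in each chain, as no point is further
     left or right. Any other point is on one chain, with at most two neighbours there and at most
     one partner. *)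
  have [ip|ip] := eqVneq i p.
    have noleft j : ~ X j < X i.
      by rewrite ip Pp /=; have := abscissa_ge0_le1 luneP j; lra.
    apply: (@card_le3 _ _ (U i) (L i) pred0) => // j /cases[[h|h|h|h]|[/MY|/MY]].
    + by constructor 1.
    + by case: (noleft j); apply: Ult.
    + by constructor 2.
    + by case: (noleft j); apply: Llt.
    + by rewrite ip Pp /= ltxx; case.
    + by rewrite ip Pp /= ltxx; case.
  have [iq|iq] := eqVneq i q.
    have noright j : ~ X i < X j.
      by rewrite iq Pq /=; have := abscissa_ge0_le1 luneP j; lra.
    apply: (@card_le3 _ _ (U^~ i) (L^~ i) pred0) => // j /cases[[h|h|h|h]|[/MY|/MY]].
    + by case: (noright j); apply: Ult.
    + by constructor 1.
    + by case: (noright j); apply: Llt.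
    + by constructor 2.
    + by rewrite iq Pq /= ltxx; case.
    + by rewrite iq Pq /= ltxx; case.
  have := ordinate_neq0 convP Pp Pq luneP ip iq; case: (ltgtP 0 (Y i)) => // yi _.
    have nlow : ~~ upper Q p q i.
      by rewrite lowerE (negPf ip) (negPf iq) /= -leNgt ltW.
    apply: (@card_le3 _ _ (U i) (U^~ i) (fun j => (i, j) \in M)) => //.
    move=> j /cases[[h|h|/Llow[h _]|/Llow[_ h]]|[h|/MY[_ h]]].
    + by constructor 1.
    + by constructor 2.
    + by rewrite h in nlow.
    + by rewrite h in nlow.
    + by constructor 3.
    + by have := lt_trans h yi; rewrite ltxx.
  have nup : ~~ upper P p q i.
    by rewrite /upper (negPf ip) (negPf iq) /= -leNgt ltW.
  apply: (@card_le3 _ _ (L i) (L^~ i) (fun j => (j, i) \in M)) => //.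
  move=> j /cases[[/Uup[h _]|/Uup[_ h]|h|h]|[/MY[h _]|h]].
  + by rewrite h in nup.
  + by rewrite h in nup.
  + by constructor 1.
  + by constructor 2.
  + by have := lt_trans h yi; rewrite ltxx.
  + by constructor 3.
Qed.
End NormalizedSpanner.

(** * Transfer along a similarity: multiplication by the complex number [a + i b], then translation
    by [o] *)

Section Similarity.
Variables (R : realType) (n : nat) (P Q : 'I_n -> R * R) (o : R * R) (a b : R).
Hypothesis ab_gt0 : 0 < a ^+ 2 + b ^+ 2.
Hypothesis PE : forall i,
  P i = (o.1 + a * (Q i).1 - b * (Q i).2, o.2 + b * (Q i).1 + a * (Q i).2).

Lemma similarity_edist i j :
  edist (P i) (P j) = Num.sqrt (a ^+ 2 + b ^+ 2) * edist (Q i) (Q j).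
Proof.
by rewrite /edist -sqrtrM ?(ltW ab_gt0) // !PE /=; congr Num.sqrt; ring.
Qed.

Lemma similarity_stretch (E : rel 'I_n) t : stretch_at_most Q E t -> stretch_at_most P E t.
Proof.
move=> st u v; have [s [ps ls ws]] := st u v; exists s; split=> //.
have -> : walk_length P u s = Num.sqrt (a ^+ 2 + b ^+ 2) * walk_length Q u s.
  elim: s u {ps ls ws} => [|w s IH] u /=; first by rewrite mulr0.
  by rewrite similarity_edist IH mulrDr.
by rewrite similarity_edist mulrCA ler_wpM2l ?sqrtr_ge0.
Qed.

Lemma similarity_plane (E : rel 'I_n) : plane Q E -> plane P E.
Proof.
pose D := a ^+ 2 + b ^+ 2.
(* The inverse similarity, which carries a common point of two edges back to the normalized
   picture. *)
pose f (x : R * R) : R * R := ((a * (x.1 - o.1) + b * (x.2 - o.2)) / D,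
  (a * (x.2 - o.2) - b * (x.1 - o.1)) / D).
have D0 : D != 0 by rewrite gt_eqF.
have fP i : f (P i) = Q i.
  by rewrite /f PE /= [RHS]surjective_pairing; congr pair; rewrite /D; field.
have f_inj x y : f x = f y -> x = y.
  case: x y => [x1 x2] [y1 y2] [/(mulIf (invr_neq0 D0)) e1 /(mulIf (invr_neq0 D0)) e2].
  congr pair; apply: (mulfI D0).
    transitivity (a * (a * (x1 - o.1) + b * (x2 - o.2))
      - b * (a * (x2 - o.2) - b * (x1 - o.1)) + D * o.1); first by rewrite /D; ring.
    by rewrite e1 e2 /D; ring.
  transitivity (b * (a * (x1 - o.1) + b * (x2 - o.2))
      + a * (a * (x2 - o.2) - b * (x1 - o.1)) + D * o.2); first by rewrite /D; ring.
  by rewrite e1 e2 /D; ring.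
have seg i j x : on_segment (P i) (P j) x -> on_segment (Q i) (Q j) (f x).
  case=> t [t01 ->]; exists t; split=> //.
  by rewrite -!fP /f /=; congr pair; ring.
move=> plQ i j k l Eij Ekl ns x /seg xij /seg xkl.
have [h1 h2] := plQ i j k l Eij Ekl ns _ xij xkl.
by split; [case: h1 => h|case: h2 => h]; rewrite -fP in h; move/f_inj: h; auto.
Qed.
End Similarity.

Theorem theorem3 (R : realType) (n : nat) (P : 'I_n -> R * R) :
  injective P -> convex_position P ->
  exists E : rel 'I_n,
    [/\ simple_graph E, plane P E,
        stretch_at_most P E ((3 + 4 * pi) / 3) & max_degree_le E 3].
Proof.
move=> injP convP.
have [/forallP triv|/forallPn[p0 /forallPn[q0 pq0]]] :=
    boolP [forall i : 'I_n, forall j : 'I_n, i == j].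
  (* With at most one point, the empty graph will do. *)
  exists (fun _ _ => false); split=> //.
  - move=> u v; have /forallP/(_ v)/eqP <- := triv u.
    exists [::]; split=> //=; rewrite mulr_ge0 ?sqrtr_ge0 //.
    by have := @pi_gt0 R; lra.
  - by move=> i; rewrite eq_card0.
have [[p q] /= _ diam] := arg_maxP (fun e : 'I_n * 'I_n => edist (P e.1) (P e.2))
  (isT : predT (p0, q0)).
have {}diam i j : edist (P i) (P j) <= edist (P p) (P q) by apply: (diam (i, j)).
pose o := P p; pose a := (P q).1 - (P p).1; pose b := (P q).2 - (P p).2.
pose D := a ^+ 2 + b ^+ 2.
have D_ge0 : 0 <= D by rewrite addr_ge0 ?sqr_ge0.
have DE : edist (P p) (P q) = Num.sqrt D.
  by congr Num.sqrt; rewrite /D /a /b; ring.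
have D_gt0 : 0 < D.
  (* A zero diameter would identify the distinct points [P p0] and [P q0]. *)
  rewrite lt_neqAle D_ge0 andbT; apply: contraNneq pq0 => D0.
  have := diam p0 q0; rewrite DE -D0 sqrtr0 => d0.
  have : Num.sqrt (((P p0).1 - (P q0).1) ^+ 2 + ((P p0).2 - (P q0).2) ^+ 2) == 0.
    by rewrite eq_le d0 sqrtr_ge0.
  rewrite sqrtr_eq0 -(inj_eq injP) => le0.
  have h1 := sqr_ge0 ((P p0).1 - (P q0).1); have h2 := sqr_ge0 ((P p0).2 - (P q0).2).
  rewrite [P p0]surjective_pairing [P q0]surjective_pairing xpair_eqE.
  by rewrite -subr_eq0 -sqrf_eq0 -(subr_eq0 (P p0).2) -[_ - _ == 0]sqrf_eq0 !eq_le h1 h2; lra.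
(* The similarity taking [P p] to [(0, 0)] and [P q] to [(1, 0)]; the diameter becomes 1, which puts
   all points in the lune. *)
pose Q i : R * R := ((a * ((P i).1 - o.1) + b * ((P i).2 - o.2)) / D,
  (a * ((P i).2 - o.2) - b * ((P i).1 - o.1)) / D).
have Dn0 : D != 0 by rewrite gt_eqF.
have PE i : P i = (o.1 + a * (Q i).1 - b * (Q i).2, o.2 + b * (Q i).1 + a * (Q i).2).
  rewrite [LHS]surjective_pairing /Q /=.
  by congr pair; apply: (mulfI Dn0); rewrite /D in Dn0 *; field.
have Qp : Q p = (0, 0) by rewrite /Q /o !subrr !mulr0 subr0 addr0 mul0r.
have Qq : Q q = (1, 0).
  by rewrite /Q -/a -/b (_ : a * b - b * a = 0) ?mul0r; [congr pair; rewrite -?expr2 divff|ring].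
have distQ i j : ((Q i).1 - (Q j).1) ^+ 2 + ((Q i).2 - (Q j).2) ^+ 2 <= 1.
  have := diam i j; rewrite (similarity_edist D_gt0 PE) DE.
  rewrite -[leRHS]mulr1 ler_pM2l ?sqrtr_gt0 // -{1}sqrtr1 ler_sqrt //.
have luneQ i : in_lune (Q i).
  have := distQ i p; have := distQ i q; rewrite Qp Qq /= !subr0; by split.
have convQ : convex_position Q.
  apply: (@convex_position_affine R n P Q o.1 o.2 a (- b) b a) convP => i.
  by rewrite [LHS]PE; congr pair; ring.
have [E [simpE planeE stretchE degE]] := normalized_spanner convQ Qp Qq luneQ.
exists E; split=> //.
- exact: (similarity_plane D_gt0 PE planeE).
- exact: (similarity_stretch D_gt0 PE stretchE).
Qed.
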